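(* Let $(\beta,\theta)$ be a structural parameter, $\beta$ in a parameter space in $\mathbb{R}^p$ and $\theta\in\Theta\subseteq\mathbb{R}^q$, and let $\theta_0\in\Theta$. For each sample size $T$ let $g_T^{(L)}(\beta,\theta)$ be an $\mathbb{R}^k$-valued stochastic process with distribution described by $P\in\mathcal{P}_0$ and let $m_T^{(L)}(\beta,\theta)$ be the associated deterministic $\mathbb{R}^k$-valued mean function. Suppose the following (with $\beta(\cdot)$, $m_T^{(L)}$, $M_T$, $\mathbb{G}$, $\Sigma_L$ allowed to depend on $P$): (A1) There exist a function $\beta(\theta)$, which for all $\theta$ belongs to the interior of the parameter space for $\beta$ and satisfies $m_T^{(L)}(\beta(\theta_0),\theta_0)=0$, and an estimator $\widehat\beta(\theta)$, such that $$\lim_{T\to\infty}\sup_{P\in\mathcal{P}_0}\sup_{f\in BL_1}\left|E_P\left[f\begin{pmatrix}g_T^{(L)}(\beta,\theta)-m_T^{(L)}(\beta,\theta)\\ \sqrt{T}(\widehat\beta(\theta)-\beta(\theta))\end{pmatrix}\right]-E[f(\mathbb{G})]\right|=0,$$ where $\mathbb{G}=(G^{(L)}(\beta,\theta),G_\beta(\theta))$ is a mean-zero Gaussian process with covariance function $\Sigma_L(\beta,\theta,\beta_1,\theta_1)$, and $\mathbb{G}$ is uniformly equicontinuous and uniformly bounded over $\mathcal{P}_0$. (A2) For some fixed $\bar\lambda>0$ and any sequence $\delta_T\to0$, $$1/\bar\lambda\le\inf_{P\in\mathcal{P}_0}\inf_\theta\lambda_{\min}(\Sigma_L(\beta(\theta),\theta,\beta(\theta),\theta))\le\sup_{P\in\mathcal{P}_0}\sup_\theta\lambda_{\max}(\Sigma_L(\beta(\theta),\theta,\beta(\theta),\theta))\le\bar\lambda,$$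 $$\lim_{T\to\infty}\sup_{P\in\mathcal{P}_0}\sup_{\theta,\theta_1}\sup_{\|\beta-\beta(\theta)\|<\delta_T}\sup_{\|\beta_1-\beta(\theta_1)\|<\delta_T}\|\Sigma_L(\beta,\theta,\beta_1,\theta_1)-\Sigma_L(\beta(\theta),\theta,\beta(\theta_1),\theta_1)\|=0.$$ (A3) There is an estimator $\widehat\Sigma_L$ of $\Sigma_L$ such that for any $\varepsilon>0$, $$\lim_{T\to\infty}\sup_{P\in\mathcal{P}_0}P\left\{\sup_{\beta,\theta,\beta_1,\theta_1}\|\widehat\Sigma_L(\beta,\theta,\beta_1,\theta_1)-\Sigma_L(\beta,\theta,\beta_1,\theta_1)\|>\varepsilon\right\}=0.$$ (A4) For some sequence $\delta_T\to\infty$ with $\delta_T/\sqrt T\to0$, for each $P\in\mathcal{P}_0$ there exists a deterministic sequence of $k\times p$ matrix-valued functions $M_T(\theta)$ such that $$\lim_{T\to\infty}\sup_{P\in\mathcal{P}_0}\sup_\theta\sup_{\sqrt T\|\beta-\beta(\theta)\|\le\delta_T}\left\|m_T^{(L)}(\beta,\theta)-m_T^{(L)}(\beta(\theta),\theta)-M_T(\theta)\sqrt T(\beta-\beta(\theta))\right\|=0;$$ the $M_T$ are uniformly bounded, $\sup_{P\in\mathcal{P}_0}\sup_\theta\|M_T(\theta)\|<\infty$ (with a bound not depending on $T$); and there exists an estimator $\widehat M_T(\theta)$ such that for any $\varepsilon>0$, $\lim_{T\to\infty}\sup_{P\in\mathcal{P}_0}P\{\sup_\theta\|\widehat M_T(\theta)-M_T(\theta)\|>\varepsilon\}=0$.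 Define $$g_T(\theta)=g_T^{(L)}(\widehat\beta(\theta),\theta),\qquad m_T(\theta)=m_T^{(L)}(\beta(\theta),\theta),$$ $$\Sigma(\theta,\theta_1)=(I_k,M_T(\theta))\,\Sigma_L(\beta(\theta),\theta,\beta(\theta_1),\theta_1)\,(I_k,M_T(\theta_1))',$$ $$\widehat\Sigma(\theta,\theta_1)=(I_k,\widehat M_T(\theta))\,\widehat\Sigma_L(\widehat\beta(\theta),\theta,\widehat\beta(\theta_1),\theta_1)\,(I_k,\widehat M_T(\theta_1))'.$$ Then: (1) with $G$ a mean-zero Gaussian process on $\Theta$ with covariance function $\Sigma$, $\displaystyle\lim_{T\to\infty}\sup_{P\in\mathcal{P}_0}\sup_{f\in BL_1}|E[f(g_T-m_T)]-E[f(G)]|=0$; (2) there is a finite $\bar\lambda_1>0$ with $\displaystyle1/\bar\lambda_1\le\inf_{P\in\mathcal{P}_0}\inf_{\theta\in\Theta}\lambda_{\min}(\Sigma(\theta,\theta))\le\sup_{P\in\mathcal{P}_0}\sup_{\theta\in\Theta}\lambda_{\max}(\Sigma(\theta,\theta))\le\bar\lambda_1$; (3) for any $\varepsilon>0$, $\displaystyle\lim_{T\to\infty}\sup_{P\in\mathcal{P}_0}P\left\{\sup_{\theta,\tilde\theta}\|\widehat\Sigma(\theta,\tilde\theta)-\Sigma(\theta,\tilde\theta)\|>\varepsilon\right\}=0$.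
   Context: $\lambda_{\min}(A)$, $\lambda_{\max}(A)$ are the minimal and maximal eigenvalues of $A$; $\|\cdot\|$ is the Euclidean norm for vectors and the operator norm for matrices; $I_k$ is the $k\times k$ identity. $BL_1$ is the set of real functionals (on the relevant space of vector-valued functions with the sup norm) with Lipschitz constant and supremum norm bounded above by one; expectations are understood with the usual measurability conventions for weak convergence of stochastic processes (van der Vaart and Wellner). $\Sigma_L(\beta,\theta,\beta_1,\theta_1)=E[\mathbb{G}(\beta,\theta)\mathbb{G}(\beta_1,\theta_1)']$ is $(k+p)\times(k+p)$. ''Uniformly bounded over $\mathcal{P}_0$'' means: for every $\varepsilon>0$ there is $C$ with $\sup_{P\in\mathcal{P}_0}P\{\sup_{\beta,\theta}\|\mathbb{G}(\beta,\theta)\|>C\}<\varepsilon$; ''uniformly equicontinuous over $\mathcal{P}_0$'' means: for all $\varepsilon,\eta>0$ there is $\delta>0$ with $\sup_{P\in\mathcal{P}_0}P\{\sup_{\|(\beta,\theta)-(\beta_1,\theta_1)\|<\delta}\|\mathbb{G}(\beta,\theta)-\mathbb{G}(\beta_1,\theta_1)\|>\eta\}<\varepsilon$. Since $M_T$ may vary with $T$, so may $\Sigma$ and the law of $G$; the bound in (2) holds with a constant not depending on $T$. *)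

(* Defs.v *)
From HB Require Import structures.
From mathcomp Require Import all_boot all_order all_algebra.
From mathcomp Require Import all_classical all_reals all_analysis.
From mathcomp Require Import measurable_realfun.

Set Implicit Arguments.
Unset Strict Implicit.
Unset Printing Implicit Defensive.

Import Order.TTheory GRing.Theory Num.Theory.
Import numFieldNormedType.Exports.

Local Open Scope classical_set_scope.
Local Open Scope ring_scope.

Notation "\usup_ ( x 'in' A ) F" := (ereal_sup [set F | x in A])
  (at level 41, x binder, A at level 60, F at level 41) : ereal_scope.
Notation "\uinf_ ( x 'in' A ) F" := (ereal_inf [set F | x in A])
  (at level 41, x binder, A at level 60, F at level 41) : ereal_scope.

Section linear_algebra.
Context {R : realType}.

(* The norm that the library puts on matrices is the max norm, hence the
   following two. *)
Definition enorm n (x : 'cV[R]_n) : R := Num.sqrt (\sum_i x i 0 ^+ 2).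

Definition opnorm m n (A : 'M[R]_(m, n)) : R :=
  sup [set enorm (A *m x) | x in [set x : 'cV[R]_n | enorm x <= 1]].

(* Meaningful when [A] has a real eigenvalue, e.g. for [A] symmetric and
   [0 < n]. *)
Definition lambda_min n (A : 'M[R]_n) : R := inf [set a | eigenvalue A a].
Definition lambda_max n (A : 'M[R]_n) : R := sup [set a | eigenvalue A a].

(* (I_k, M(s)) S(b(s), s, b(t), t) (I_k, M(t))' *)
Definition concentrated_cov k p q (M : 'cV[R]_q -> 'M[R]_(k, p))
    (S : 'cV[R]_p -> 'cV[R]_q -> 'cV[R]_p -> 'cV[R]_q -> 'M[R]_(k + p))
    (b : 'cV[R]_q -> 'cV[R]_p) (s t : 'cV[R]_q) : 'M[R]_k :=
  row_mx 1%:M (M s) *m S (b s) s (b t) t *m (row_mx 1%:M (M t))^T.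

End linear_algebra.

Section outer.
Context {d} {W : measurableType d} {R : realType}.
Local Open Scope ereal_scope.

Definition outer_prob (P : probability W R) (A : set W) : \bar R :=
  \uinf_(D in [set D | measurable D /\ A `<=` D]) P D.

(* The disjunction says that the expectation of [U] exists. *)
Definition outer_expectation (P : probability W R) (h : W -> \bar R) : \bar R :=
  \uinf_(U in [set U : W -> \bar R |
      [/\ measurable_fun setT U,
          (\int[P]_w U^\+ w < +oo) \/ (\int[P]_w U^\- w < +oo) &
          forall w, h w <= U w]])
    \int[P]_w U w.

End outer.

Section bounded_lipschitz.
Context {R : realType} {I : Type} {n : nat}.
Implicit Types (A : set I) (x y : I -> 'cV[R]_n).
Local Open Scope ereal_scope.

(* Sample paths indexed by [A] are represented by total functions [I -> R^n];
   [supdist A] ignores their values outside [A], and it may be +oo since the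
   paths are not required to be bounded. *)
Definition supdist A x y : \bar R := \usup_(i in A) (enorm (x i - y i))%:E.

(* Paths at infinite distance are unrelated; on the bounded paths these are the
   functionals on l^oo(A; R^n) with sup norm and Lipschitz constant at most 1. *)
Definition BL1 A : set ((I -> 'cV[R]_n) -> R) :=
  [set f | (forall x, (`|f x| <= 1)%R) /\
           (forall x y, `|f x - f y|%:E <= supdist A x y)].

End bounded_lipschitz.

Section processes.
Context {R : realType} {I : Type} {n : nat}.
Local Open Scope ereal_scope.

(* The law of [X] is only reached through outer expectations, [X] being an
   arbitrary map; the limit [Y] is meant to satisfy [borel_element]. *)
Definition BL_dist d (W : measurableType d) d' (W' : measurableType d')
    (A : set I) (P : probability W R) (X : W -> I -> 'cV[R]_n)
    (Q : probability W' R) (Y : W' -> I -> 'cV[R]_n) : \bar R :=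
  \usup_(f in BL1 A)
    `| outer_expectation P (fun w => (f (X w))%:E) - 'E_Q[fun w => f (Y w)] |.

Context {d : measure_display} {W : measurableType d}.
Implicit Types (A : set I) (Q : probability W R) (X : W -> I -> 'cV[R]_n).

(* Borel measurability of [X] for the topology of uniform convergence on [A]:
   the truncated distance to a set is a BL_1 functional. *)
Definition borel_element A X :=
  forall f, BL1 A f -> measurable_fun setT (fun w => f (X w)).

(* [normal_prob m 0] is not the point mass at [m]. *)
Definition gaussian_law (m s : R) (D : set R) : \bar R :=
  if s == 0%R then \d_m D else normal_prob m s D.

Definition gaussian_process Q A X :=
  (forall i, A i -> forall j, measurable_fun setT (fun w => X w i j ord0)) /\
  (forall (N : nat) (t : 'I_N -> I) (c : 'I_N -> 'cV[R]_n),
    (forall l, A (t l)) ->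
    exists m s : R, forall D : set R, measurable D ->
      Q [set w | D ((\sum_l (c l)^T *m X w (t l))%R ord0 ord0)] =
      gaussian_law m s D).

(* Equality to a finite value forces the expectations below to be those of
   integrable functions. *)
Definition mean_zero Q A X :=
  forall i, A i -> forall j, 'E_Q[fun w => X w i j ord0] = 0.

Definition covariance_function Q A X (K : I -> I -> 'M[R]_n) :=
  forall s t, A s -> A t -> forall i j,
    'E_Q[fun w => X w s i ord0 * X w t j ord0]%R = (K s t i j)%:E.

Definition mean_zero_gaussian_process Q A X K :=
  [/\ gaussian_process Q A X, mean_zero Q A X & covariance_function Q A X K].

End processes.

Section uniformity.
Context {R : realType} {p q n : nat}.
Context {d : measure_display} {W : measurableType d} {J : Type}.
Implicit Types (A : set ('cV[R]_p * 'cV[R]_q)) (PP : set J).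
Implicit Types (Q : J -> probability W R).
Implicit Types (X : J -> W -> 'cV[R]_p * 'cV[R]_q -> 'cV[R]_n).
Local Open Scope ereal_scope.

Definition uniformly_bounded PP A Q X :=
  forall eps : R, (0 < eps)%R -> exists C : R,
    \usup_(P in PP) outer_prob (Q P)
      [set w | C%:E < \usup_(z in A) (enorm (X P w z))%:E] < eps%:E.

Definition uniformly_equicontinuous PP A Q X :=
  forall eps eta : R, (0 < eps)%R -> (0 < eta)%R ->
  exists2 delta : R, (0 < delta)%R &
    \usup_(P in PP) outer_prob (Q P)
      [set w | eta%:E <
        \usup_(u in [set u | [/\ A u.1, A u.2 &
            (enorm (col_mx (u.1.1 - u.2.1) (u.1.2 - u.2.2)) < delta)%R]])
          (enorm (X P w u.1 - X P w u.2))%:E] < eps%:E.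

End uniformity.

(* Main.v *)
Require Import Defs.
From HB Require Import structures.
From mathcomp Require Import all_boot all_order all_algebra.
From mathcomp Require Import all_classical all_reals all_analysis.
From mathcomp Require Import measurable_realfun.
From mathcomp Require Import ring lra.

(* Write x_T for the centred process of (A1) and Phi for the map sending a path x
   to t |-> (I, M_T(t)) x(beta(t), t), which is Lipschitz for the sup norm.  The
   limit in (1) is Phi(GG).  By (A4), g_T - m_T differs from Phi(x_T) by at most
   the modulus of continuity of x_T in beta, as soon as x_T is bounded.  The
   truncated modulus and the truncated size are themselves Lipschitz functionals
   of the path, so the bound
     |f(g_T - m_T) - f(Phi(x_T))| <= 2 modulus(x_T) + 2 size(x_T) + r
   is passed to the limit GG by (A1), where equicontinuity and boundedness make
   it small.  (2) compares Rayleigh quotients.  In (3) the cross covariances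
   Sigma_L(s, t) are bounded through those at s = t by E(U - V)^2 >= 0, and
   beta-hat is consistent since the size functional of x_T is tight. *)

Set Implicit Arguments.
Unset Strict Implicit.
Unset Printing Implicit Defensive.

Import Order.TTheory GRing.Theory Num.Theory.
Import numFieldNormedType.Exports.

Local Open Scope classical_set_scope.
Local Open Scope ring_scope.

(** The sample processes are arbitrary maps, so they are seen only through outer expectations, which
    are monotone and positively homogeneous but not additive. Hence the error of replacing g_T - m_T
    by Phi(x_T) cannot be integrated separately: f(g_T - m_T) is enclosed pointwise between two
    Lipschitz functionals of x_T, f o Phi minus and plus the error bound, and (A1) is applied to
    each of them. The Lipschitz constant of Phi depends only on the bound of M_T, so one rate serves
    all P and T. As Phi is linear, its image of GG is Gaussian on the same probability space, and no
    process has to be constructed. Sample paths may be unbounded, which is why modulus and size are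
    truncated at 1; once a truncation is reached, the trivial bound 2 on a difference of values of f
    takes over, hence the factors 2. Otherwise sqrt(T) |betahat - beta| <= C + 1 for a fixed C: for
    large T this is within the radius delta_T of (A4) and below sqrt(T) times the equicontinuity
    radius, and in (3) it supplies a vanishing sequence for (A2). *)

Section euclidean.
Context {R : realType}.

Definition dot n (x y : 'cV[R]_n) : R := (x^T *m y) 0 0.

Lemma dotC n (x y : 'cV[R]_n) : dot x y = dot y x.
Proof.
by rewrite /dot -[x^T *m y]trmxK trmx_mul trmxK mxE.
Qed.

Lemma dotDr n (x y z : 'cV[R]_n) : dot x (y + z) = dot x y + dot x z.
Proof. by rewrite /dot mulmxDr mxE. Qed.

Lemma dotZr n a (x y : 'cV[R]_n) : dot x (a *: y) = a * dot x y.
Proof. by rewrite /dot -scalemxAr mxE. Qed.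

Lemma dotDl n (x y z : 'cV[R]_n) : dot (x + y) z = dot x z + dot y z.
Proof. by rewrite dotC dotDr !(dotC z). Qed.

Lemma dotZl n a (x y : 'cV[R]_n) : dot (a *: x) y = a * dot x y.
Proof. by rewrite dotC dotZr dotC. Qed.

Lemma dot_mulmx m n (A : 'M[R]_(m, n)) x y :
  dot x (A *m y) = dot (A^T *m x) y.
Proof. by rewrite /dot mulmxA trmx_mul trmxK. Qed.

Lemma dotxx n (x : 'cV[R]_n) : dot x x = \sum_i x i 0 ^+ 2.
Proof. by rewrite /dot mxE; apply: eq_bigr => i _; rewrite mxE expr2. Qed.

Lemma dotxx_ge0 n (x : 'cV[R]_n) : 0 <= dot x x.
Proof. by rewrite dotxx sumr_ge0// => i _; exact: sqr_ge0. Qed.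

Lemma dotxx_eq0 n (x : 'cV[R]_n) : (dot x x == 0) = (x == 0).
Proof.
apply/idP/eqP => [|->]; last by rewrite /dot mulmx0 mxE.
rewrite dotxx psumr_eq0; last by move=> i _; exact: sqr_ge0.
move=> /allP x0; apply/colP => i; rewrite mxE.
by have := x0 i (mem_index_enum i); rewrite implyTb sqrf_eq0 => /eqP.
Qed.

Lemma enorm_ge0 n (x : 'cV[R]_n) : 0 <= enorm x.
Proof. exact: sqrtr_ge0. Qed.

Lemma enorm_sq n (x : 'cV[R]_n) : enorm x ^+ 2 = dot x x.
Proof. by rewrite dotxx /enorm sqr_sqrtr// -dotxx dotxx_ge0. Qed.

Lemma enorm_eq0 n (x : 'cV[R]_n) : (enorm x == 0) = (x == 0).
Proof. by rewrite -dotxx_eq0 -enorm_sq sqrf_eq0. Qed.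

Lemma enorm0 n : enorm (0 : 'cV[R]_n) = 0.
Proof. by apply/eqP; rewrite enorm_eq0. Qed.

Lemma enorm_le n m (x : 'cV[R]_n) (y : 'cV[R]_m) c :
  0 <= c -> (enorm x <= c * enorm y) = (dot x x <= c ^+ 2 * dot y y).
Proof.
move=> c0; rewrite -!enorm_sq -exprMn ler_pXn2r// nnegrE ?enorm_ge0//.
by rewrite mulr_ge0 ?enorm_ge0.
Qed.

Lemma enormZ n a (x : 'cV[R]_n) : enorm (a *: x) = `|a| * enorm x.
Proof.
apply/eqP; rewrite -(@eqrXn2 _ 2)//; last 2 first.
- exact: enorm_ge0.
- by rewrite mulr_ge0 ?enorm_ge0.
by rewrite exprMn !enorm_sq dotZl dotZr mulrA -expr2 real_normK ?num_real.
Qed.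

Lemma enormN n (x : 'cV[R]_n) : enorm (- x) = enorm x.
Proof. by rewrite -scaleN1r enormZ normrN1 mul1r. Qed.

Lemma enorm_distC n (x y : 'cV[R]_n) : enorm (x - y) = enorm (y - x).
Proof. by rewrite -enormN opprB. Qed.

Lemma dot_le n (x y : 'cV[R]_n) : `|dot x y| <= enorm x * enorm y.
Proof.
have [->|y0] := eqVneq y 0.
  by rewrite {1}/dot mulmx0 mxE normr0 mulr_ge0 ?enorm_ge0.
rewrite -(@ler_pXn2r _ 2) ?nnegrE ?mulr_ge0 ?enorm_ge0//.
rewrite exprMn !enorm_sq real_normK ?num_real//.
have yy : 0 < dot y y by rewrite lt_neqAle eq_sym dotxx_eq0 y0 dotxx_ge0.
have := dotxx_ge0 (dot y y *: x + (- dot x y) *: y).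
rewrite !(dotDl, dotDr, dotZl, dotZr) (dotC y x).
set a := dot x x; set b := dot y y; set c := dot x y.
rewrite (_ : _ + _ = b * (a * b - c ^+ 2)); last by ring.
by rewrite pmulr_rge0// subr_ge0.
Qed.

Lemma enormD n (x y : 'cV[R]_n) : enorm (x + y) <= enorm x + enorm y.
Proof.
rewrite -(@ler_pXn2r _ 2) ?nnegrE ?addr_ge0 ?enorm_ge0//.
rewrite enorm_sq dotDl !dotDr (dotC y x) sqrrD !enorm_sq.
have := le_trans (ler_norm _) (dot_le x y); lra.
Qed.

Lemma enormB n (x y : 'cV[R]_n) : enorm (x - y) <= enorm x + enorm y.
Proof. by rewrite (le_trans (enormD _ _))// enormN. Qed.

Lemma dot_col_mx k p (a c : 'cV[R]_k) (b d : 'cV[R]_p) :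
  dot (col_mx a b) (col_mx c d) = dot a c + dot b d.
Proof. by rewrite /dot tr_col_mx mul_row_col mxE. Qed.

Lemma enorm_col_mx_up k p (a : 'cV[R]_k) (b : 'cV[R]_p) :
  enorm a <= enorm (col_mx a b).
Proof.
by rewrite -[leRHS]mul1r enorm_le// expr1n mul1r dot_col_mx lerDl dotxx_ge0.
Qed.

Lemma enorm_col_mx_down k p (a : 'cV[R]_k) (b : 'cV[R]_p) :
  enorm b <= enorm (col_mx a b).
Proof.
by rewrite -[leRHS]mul1r enorm_le// expr1n mul1r dot_col_mx lerDr dotxx_ge0.
Qed.

Lemma enorm_col_mx0 k p (a : 'cV[R]_k) :
  enorm (col_mx a (0 : 'cV[R]_p)) = enorm a.
Proof.
apply/eqP; rewrite -(@eqrXn2 _ 2) ?enorm_ge0// !enorm_sq dot_col_mx.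
by rewrite {2}/dot mulmx0 mxE addr0.
Qed.

End euclidean.

(** * The Euclidean operator norm *)

Section operator_norm.
Context {R : realType}.

(** Cauchy-Schwarz on each row, with the Frobenius norm as constant. It makes the set in [opnorm]
    bounded above, so that its [sup] is a genuine supremum. *)
Lemma enorm_mulmx_bound m n (A : 'M[R]_(m, n)) :
  exists2 c, 0 <= c & forall x, enorm (A *m x) <= c * enorm x.
Proof.
pose c2 := \sum_i dot (row i A)^T (row i A)^T.
have c20 : 0 <= c2 by apply: sumr_ge0 => i _; exact: dotxx_ge0.
exists (Num.sqrt c2) => [|x]; first exact: sqrtr_ge0.
rewrite enorm_le ?sqrtr_ge0// sqr_sqrtr// [leLHS]dotxx mulr_suml.
apply: ler_sum => i _.
have -> : (A *m x) i 0 = dot (row i A)^T x.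
  by rewrite /dot trmxK -row_mul [RHS]mxE.
rewrite -real_normK ?num_real// -!enorm_sq -exprMn.
by rewrite ler_pXn2r ?nnegrE ?mulr_ge0 ?enorm_ge0// dot_le.
Qed.

Lemma opnorm_le m n (A : 'M[R]_(m, n)) c : 0 <= c ->
  (forall x, enorm (A *m x) <= c * enorm x) -> opnorm A <= c.
Proof.
move=> c0 Ac; apply: ge_sup.
  by exists (enorm (A *m 0)), 0 => //=; rewrite enorm0 ler01.
move=> _ [x /= x1 <-]; apply: le_trans (Ac x) _.
by rewrite -[leRHS]mulr1 ler_wpM2l.
Qed.

Lemma enorm_mulmx m n (A : 'M[R]_(m, n)) x :
  enorm (A *m x) <= opnorm A * enorm x.
Proof.
have [c c0 Ac] := enorm_mulmx_bound A.
have [->|x0] := eqVneq x 0; first by rewrite mulmx0 !enorm0 mulr0.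
have nx : 0 < enorm x by rewrite lt_neqAle eq_sym enorm_eq0 x0 enorm_ge0.
rewrite -ler_pdivrMr// mulrC -[_^-1]ger0_norm ?invr_ge0 ?enorm_ge0//.
rewrite -enormZ scalemxAr; apply: ub_le_sup.
  exists c => _ [y /= y1 <-]; apply: le_trans (Ac y) _.
  by rewrite -[leRHS]mulr1 ler_wpM2l.
exists ((enorm x)^-1 *: x) => //=.
by rewrite enormZ ger0_norm ?invr_ge0 ?enorm_ge0// mulVf ?gt_eqF.
Qed.

Lemma opnorm_ge0 m n (A : 'M[R]_(m, n)) : 0 <= opnorm A.
Proof.
have [c c0 Ac] := enorm_mulmx_bound A.
apply: ub_le_sup.
  exists c => _ [y /= y1 <-]; apply: le_trans (Ac y) _.
  by rewrite -[leRHS]mulr1 ler_wpM2l.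
by exists 0 => /=; rewrite ?mulmx0 enorm0// ler01.
Qed.

Lemma opnormD m n (A B : 'M[R]_(m, n)) : opnorm (A + B) <= opnorm A + opnorm B.
Proof.
apply: opnorm_le => [|x]; first by rewrite addr_ge0 ?opnorm_ge0.
by rewrite mulmxDl mulrDl (le_trans (enormD _ _))// lerD ?enorm_mulmx.
Qed.

Lemma opnormM m n l (A : 'M[R]_(m, n)) (B : 'M[R]_(n, l)) :
  opnorm (A *m B) <= opnorm A * opnorm B.
Proof.
apply: opnorm_le => [|x]; first by rewrite mulr_ge0 ?opnorm_ge0.
rewrite -mulmxA (le_trans (enorm_mulmx _ _))// -mulrA ler_wpM2l ?opnorm_ge0//.
exact: enorm_mulmx.
Qed.

(** Test the bilinear form at x = A y and divide by |A y|. *)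
Lemma opnorm_le_dot m n (A : 'M[R]_(m, n)) c : 0 <= c ->
  (forall x y, dot x (A *m y) <= c * enorm x * enorm y) -> opnorm A <= c.
Proof.
move=> c0 Ac; apply: opnorm_le => // y.
have [->|Ay0] := eqVneq (A *m y) 0; first by rewrite enorm0 mulr_ge0 ?enorm_ge0.
have nAy : 0 < enorm (A *m y).
  by rewrite lt_neqAle eq_sym enorm_eq0 Ay0 enorm_ge0.
rewrite -(ler_pM2l nAy) -expr2 enorm_sq (le_trans (Ac _ _))//.
by rewrite (mulrC c) mulrA.
Qed.

Lemma opnorm_tr m n (A : 'M[R]_(m, n)) : opnorm A^T <= opnorm A.
Proof.
apply: opnorm_le_dot => [|x y]; first exact: opnorm_ge0.
rewrite dot_mulmx trmxK (le_trans (ler_norm _))// (le_trans (dot_le _ _))//.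
by rewrite ler_wpM2r ?enorm_ge0// enorm_mulmx.
Qed.

Lemma opnorm_row_mx k p (M : 'M[R]_(k, p)) :
  opnorm (row_mx 1%:M M) <= 1 + opnorm M.
Proof.
apply: opnorm_le => [|x]; first by rewrite addr_ge0 ?opnorm_ge0.
rewrite -[x]vsubmxK mul_row_col mul1mx mulrDl mul1r.
rewrite (le_trans (enormD _ _))// lerD ?enorm_col_mx_up//.
rewrite (le_trans (enorm_mulmx _ _))// ler_wpM2l ?opnorm_ge0//.
exact: enorm_col_mx_down.
Qed.

(** The difference of (I, Mhat) and (I, M) has this shape. *)
Lemma opnorm_row0_mx k p (M : 'M[R]_(k, p)) :
  opnorm (row_mx (0 : 'M[R]_k) M) <= opnorm M.
Proof.
apply: opnorm_le => [|x]; first by rewrite opnorm_ge0.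
rewrite -[x]vsubmxK mul_row_col mul0mx add0r.
rewrite (le_trans (enorm_mulmx _ _))// ler_wpM2l ?opnorm_ge0//.
exact: enorm_col_mx_down.
Qed.

End operator_norm.

(** * Rayleigh quotients and extreme eigenvalues of symmetric matrices *)

Section rayleigh.
Context {R : realType}.

Lemma continuous_bigsum (V : topologicalType) (I : Type) (r : seq I)
    (f : I -> V -> R) :
  (forall i, continuous (f i)) -> continuous (fun v => \sum_(i <- r) f i v).
Proof.
move=> cf; elim: r => [|i r IH] v.
  by under eq_fun do rewrite big_nil; exact: cvg_cst.
under eq_fun do rewrite big_cons.
by apply: cvgD; [exact: cf|exact: IH].
Qed.

Lemma continuous_dot_mulmx n (A : 'M[R]_n) :
  continuous (fun v : 'rV[R]_n => dot v^T (A *m v^T)).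
Proof.
have -> : (fun v : 'rV[R]_n => dot v^T (A *m v^T)) =
    (fun v => \sum_i v 0 i * (\sum_j A i j * v 0 j)).
  apply/funext => v; rewrite /dot trmxK mxE; apply: eq_bigr => i _.
  by rewrite mxE; congr (_ * _); apply: eq_bigr => j _; rewrite mxE.
apply: continuous_bigsum => i v; apply: continuousM; first exact: coord_continuous.
move: v; apply: continuous_bigsum => j v.
apply: continuousM; first by move=> ?; exact: cst_continuous.
exact: coord_continuous.
Qed.

Lemma compact_unit_sphere n : compact [set v : 'rV[R]_n | dot v^T v^T = 1].
Proof.
pose I1 (_ : 'I_n) := [set` `[-1, 1 : R]].
apply: (@subclosed_compact _ _ [set v : 'rV[R]_n | forall i, I1 i (v ord0 i)]).
- apply: (@preimage_closed _ _ (fun v : 'rV[R]_n => dot v^T v^T) [set 1]).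
    move=> v _; have := @continuous_dot_mulmx n 1%:M v.
    rewrite /continuous_at mul1mx; under eq_fun do rewrite mul1mx; exact.
  exact: closed_eq.
- by apply: rV_compact => i; exact: segment_compact.
- move=> v /= v1 i; rewrite /I1 /= in_itv /= -ler_norml.
  rewrite -(@ler_pXn2r _ 2) ?nnegrE// expr1n -v1 real_normK ?num_real//.
  by rewrite dotxx (bigD1 i)//= mxE lerDl sumr_ge0// => j _; exact: sqr_ge0.
Qed.

(** Let x minimise the quadratic form on the unit sphere, with minimum a. Then B = A - a I is
    positive semidefinite and its form vanishes at x; this forces B x = 0, since otherwise the form
    would become negative at x + s B x for a suitable s. So x is an eigenvector. *)
Lemma symmetric_rayleigh_min n (A : 'M[R]_n) : (0 < n)%N -> A^T = A ->
  exists2 a, eigenvalue A a & forall x, a * dot x x <= dot x (A *m x).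
Proof.
move=> n0 Asym.
pose S := [set v : 'rV[R]_n | dot v^T v^T = 1].
have S0 : S !=set0.
  exists (delta_mx 0 (Ordinal n0)); rewrite /S /= /dot trmxK trmx_delta.
  by rewrite mul_delta_mx mxE !eqxx.
have [v] := EVT_min_rV S0 (@compact_unit_sphere n)
  (continuous_subspaceT (@continuous_dot_mulmx n A)).
rewrite inE /S /=; set x := v^T => x1 xmin.
pose a := dot x (A *m x).
have amin y : a * dot y y <= dot y (A *m y).
  have [->|y0] := eqVneq y 0; first by rewrite mulmx0 /dot !mulmx0 mxE mulr0.
  have yy : 0 < dot y y by rewrite lt_neqAle eq_sym dotxx_eq0 y0 dotxx_ge0.
  have ny : enorm y != 0 by rewrite enorm_eq0.
  have := xmin ((enorm y)^-1 *: y)^T; rewrite inE /= !trmxK.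
  rewrite -scalemxAr !(dotZl, dotZr) mulrA -expr2 exprVn enorm_sq mulVf ?gt_eqF//.
  move=> /(_ erefl); rewrite -/a mulrA -expr2 exprVn enorm_sq.
  by rewrite (mulrC _^-1) ler_pdivlMr.
exists a => //.
pose B := A - a%:M.
have Bge0 z : 0 <= dot z (B *m z).
  rewrite /B mulmxBl mul_scalar_mx dotDr -scaleN1r !dotZr mulN1r subr_ge0.
  exact: amin.
have Bx0 : dot x (B *m x) = 0.
  by rewrite /B mulmxBl mul_scalar_mx dotDr -scaleN1r !dotZr mulN1r x1 mulr1 subrr.
have Bsym : B^T = B by rewrite /B linearB /= tr_scalar_mx Asym.
pose y := B *m x.
have y0 : dot y y <= 0.
  (* The form at x + s y is 2 s |y|^2 + s^2 c. The minimising step would be -|y|^2 / c; the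
     denominator c + 1 avoids the case c = 0 and still gives a negative value unless y = 0. *)
  pose c := dot y (B *m y); pose s := - (dot y y / (c + 1)).
  have c1 : 0 < c + 1 by rewrite ltr_wpDl ?Bge0.
  have := Bge0 (x + s *: y).
  rewrite mulmxDr -scalemxAr !(dotDl, dotDr, dotZl, dotZr) Bx0 -/c.
  rewrite (dot_mulmx B x) Bsym -/y add0r.
  set N := dot y y.
  rewrite (_ : _ + _ = - (N ^+ 2 * (c + 2) / (c + 1) ^+ 2)); last first.
    by rewrite /s -/N; field; rewrite gt_eqF.
  rewrite oppr_ge0 pmulr_lle0 ?invr_gt0 ?exprn_gt0//.
  rewrite pmulr_lle0 ?ltr_wpDl ?Bge0// => N20.
  have : N ^+ 2 == 0 by rewrite eq_le N20 sqr_ge0.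
  by rewrite sqrf_eq0 => /eqP ->.
have {}y0 : y = 0 by apply/eqP; rewrite -dotxx_eq0 eq_le y0 dotxx_ge0.
(* [eigenvalue] speaks of row vectors, hence the transposition through the symmetry of [A]. *)
apply/eigenvalueP; exists v; last first.
  by apply/eqP => v0; move: x1; rewrite /x v0 /dot trmx0 mulmx0 mxE => /esym/eqP;
    rewrite oner_eq0.
apply: trmx_inj; rewrite trmx_mul Asym linearZ /= -/x.
by apply/eqP; rewrite -subr_eq0 -mul_scalar_mx -mulmxBl -/B -/y y0.
Qed.

Lemma symmetric_rayleigh_max n (A : 'M[R]_n) : (0 < n)%N -> A^T = A ->
  exists2 a, eigenvalue A a & forall x, dot x (A *m x) <= a * dot x x.
Proof.
move=> n0 Asym; have [|a] := @symmetric_rayleigh_min n (- A) n0.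
  by rewrite linearN /= Asym.
move=> /eigenvalueP[v vA v0] amin; exists (- a).
  by apply/eigenvalueP; exists v => //; rewrite scaleNr -vA mulmxN opprK.
move=> x; have := amin x.
by rewrite mulNmx -scaleN1r dotZr mulN1r mulNr lerNr.
Qed.

Lemma eigenvalue_dot n (A : 'M[R]_n) a : A^T = A -> eigenvalue A a ->
  exists2 x, 0 < dot x x & dot x (A *m x) = a * dot x x.
Proof.
move=> Asym /eigenvalueP[v vA v0]; exists v^T.
  by rewrite lt_neqAle eq_sym dotxx_eq0 trmx_eq0 v0 dotxx_ge0.
by rewrite -[A in LHS]Asym -trmx_mul vA linearZ dotZr.
Qed.

(** Needed for the [inf] in [lambda_min] to be a true infimum. *)
Lemma has_lbound_eigenvalue n (A : 'M[R]_n) : (0 < n)%N -> A^T = A ->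
  has_lbound [set a | eigenvalue A a].
Proof.
move=> n0 Asym; have [b _ bmin] := symmetric_rayleigh_min n0 Asym.
exists b => a /= /(eigenvalue_dot Asym)[x xx ax].
by have := bmin x; rewrite ax ler_pM2r.
Qed.

Lemma has_ubound_eigenvalue n (A : 'M[R]_n) : (0 < n)%N -> A^T = A ->
  has_ubound [set a | eigenvalue A a].
Proof.
move=> n0 Asym; have [b _ bmax] := symmetric_rayleigh_max n0 Asym.
exists b => a /= /(eigenvalue_dot Asym)[x xx ax].
by have := bmax x; rewrite ax ler_pM2r.
Qed.

Lemma lambda_min_le_dot n (A : 'M[R]_n) x : (0 < n)%N -> A^T = A ->
  lambda_min A * dot x x <= dot x (A *m x).
Proof.
move=> n0 Asym; have [b Ab bmin] := symmetric_rayleigh_min n0 Asym.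
apply: le_trans (bmin x); rewrite ler_wpM2r ?dotxx_ge0//.
by apply: ge_inf => //; exact: has_lbound_eigenvalue.
Qed.

Lemma dot_le_lambda_max n (A : 'M[R]_n) x : (0 < n)%N -> A^T = A ->
  dot x (A *m x) <= lambda_max A * dot x x.
Proof.
move=> n0 Asym; have [b Ab bmax] := symmetric_rayleigh_max n0 Asym.
apply: le_trans (bmax x) _; rewrite ler_wpM2r ?dotxx_ge0//.
by apply: ub_le_sup => //; exact: has_ubound_eigenvalue.
Qed.

Lemma lambda_min_ge n (A : 'M[R]_n) c : (0 < n)%N -> A^T = A ->
  (forall x, c * dot x x <= dot x (A *m x)) -> c <= lambda_min A.
Proof.
move=> n0 Asym cA; have [b Ab _] := symmetric_rayleigh_min n0 Asym.
apply: lb_le_inf; first by exists b.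
move=> a /= /(eigenvalue_dot Asym)[x xx ax].
by have := cA x; rewrite ax ler_pM2r.
Qed.

Lemma lambda_max_le n (A : 'M[R]_n) c : (0 < n)%N -> A^T = A ->
  (forall x, dot x (A *m x) <= c * dot x x) -> lambda_max A <= c.
Proof.
move=> n0 Asym cA; have [b Ab _] := symmetric_rayleigh_max n0 Asym.
apply: ge_sup; first by exists b.
move=> a /= /(eigenvalue_dot Asym)[x xx ax].
by have := cA x; rewrite ax ler_pM2r.
Qed.

Lemma lambda_min_le_max n (A : 'M[R]_n) : (0 < n)%N -> A^T = A ->
  lambda_min A <= lambda_max A.
Proof.
move=> n0 Asym; have [b Ab _] := symmetric_rayleigh_min n0 Asym.
apply: (@le_trans _ _ b).
- by apply: ge_inf => //; exact: has_lbound_eigenvalue.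
- by apply: ub_le_sup => //; exact: has_ubound_eigenvalue.
Qed.

End rayleigh.

(** * Outer probability and outer expectation *)

Section outer_measure.
Context {R : realType} {d : measure_display} {W : measurableType d}.
Variable P : probability W R.
Implicit Types (A B : set W) (h : W -> \bar R).
Local Open Scope ereal_scope.

Lemma le_outer_prob A B : A `<=` B -> outer_prob P A <= outer_prob P B.
Proof.
move=> AB; apply: ereal_inf_le_tmp => _ [D [mD BD] <-]; exists D => //=.
by split => //; exact: subset_trans BD.
Qed.

Lemma outer_prob_ge0 A : 0 <= outer_prob P A.
Proof. by apply: le_ereal_inf_tmp => _ [D [mD AD] <-]. Qed.

(** Strict bounds yield measurable covers whose probabilities already lie below [a] and [b]; the
    union of the covers covers the union. *)
Lemma outer_probU_lt A B a b : outer_prob P A < a -> outer_prob P B < b ->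
  outer_prob P (A `|` B) < a + b.
Proof.
move=> /ereal_inf_lt[_ [D [mD AD] <-] Da] /ereal_inf_lt[_ [E [mE BE] <-] Eb].
apply: (@le_lt_trans _ _ (P (D `|` E))).
  apply: ge_ereal_inf; exists (P (D `|` E)) => //; exists (D `|` E) => //=.
  by split; [exact: measurableU|exact: setUSS].
apply: (@le_lt_trans _ _ (P D + P E)); first exact: measureU2.
by apply: lteD.
Qed.

Lemma le_outer_expectation h h' : (forall w, h w <= h' w) ->
  outer_expectation P h <= outer_expectation P h'.
Proof.
move=> hh'; apply: ereal_inf_le_tmp => _ [U [mU iU h'U] <-]; exists U => //=.
by split => // w; exact: le_trans (h'U w).
Qed.

(** Multiplication by [k] sends measurable majorants of [g] to majorants of [k g], which gives one
    inequality; the other is the same one for the inverse factor. *)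
Lemma outer_expectationZ h (c : R) : (0 < c)%R ->
  outer_expectation P (fun w => c%:E * h w) = c%:E * outer_expectation P h.
Proof.
have half (k : R) g : (0 < k)%R ->
    outer_expectation P (fun w => k%:E * g w) <= k%:E * outer_expectation P g.
  move=> k0; rewrite -lee_pdivrMl//; apply: le_ereal_inf_tmp.
  move=> _ [U [mU iU gU] <-]; rewrite lee_pdivrMl//; apply: ge_ereal_inf.
  have pU : \int[P]_w (fun w => k%:E * U w)^\+ w = k%:E * \int[P]_w U^\+ w.
    rewrite ge0_funeposM ?ltW// ge0_integralZl_EFin ?ltW//.
    exact: measurable_funepos.
  have nU : \int[P]_w (fun w => k%:E * U w)^\- w = k%:E * \int[P]_w U^\- w.
    rewrite ge0_funenegM ?ltW// ge0_integralZl_EFin ?ltW//.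
    exact: measurable_funeneg.
  have p0 : 0 <= \int[P]_w U^\+ w by apply: integral_ge0.
  have n0 : 0 <= \int[P]_w U^\- w by apply: integral_ge0.
  exists (\int[P]_w (k%:E * U w)).
    exists (fun w => k%:E * U w) => //=; split => [|| w].
    - exact: measurable_funeM.
    - by rewrite pU nU; case: iU => iU; [left|right]; rewrite lte_mul_pinfty// lee_fin ltW.
    - by rewrite lee_pmul2l.
  rewrite integralE pU nU (integralE _ _ U).
  move: iU p0 n0; move: (\int[P]_w U^\+ w) (\int[P]_w U^\- w) => a b.
  move=> iU p0 n0; rewrite muleBr//.
  (* One of the two parts has a finite integral, so the difference is defined and multiplication
     distributes over it. *)
  case: iU => iU.
  - by apply: fin_num_adde_defr; rewrite ge0_fin_numE.
  - by apply: fin_num_adde_defl; rewrite fin_numN ge0_fin_numE.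
move=> c0; apply/eqP; rewrite eq_le half//=.
rewrite -lee_pdivlMl//; apply: le_trans (half _ _ _); last by rewrite invr_gt0.
by apply: le_outer_expectation => w; rewrite muleA -EFinM mulVf ?gt_eqF// mul1e.
Qed.

(** Markov's inequality for each measurable majorant U of [h]: the set where U >= 1 is a measurable
    cover. *)
Lemma outer_prob_le_expectation h : (forall w, 0 <= h w) ->
  outer_prob P [set w | 1 <= h w] <= outer_expectation P h.
Proof.
move=> h0; apply: le_ereal_inf_tmp => _ [U [mU iU hU] <-].
have mD : measurable [set w | 1 <= U w].
  by rewrite -[X in measurable X]setTI; exact: emeasurable_fun_c_infty.
apply: ge_ereal_inf; exists (P [set w | 1 <= U w]).
  by exists [set w | 1 <= U w] => //=; split=> // w /= /le_trans; exact.
rewrite -[X in P X]setIT -integral_indic//; apply: ge0_le_integral => //.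
- by apply/measurable_EFinP; exact: measurable_indic.
- move=> w _; rewrite indicE; have [|] := boolP (w \in _); first by rewrite inE.
  by move=> _; rewrite (le_trans (h0 w)).
Qed.

End outer_measure.

Section bounded_expectation.
Context {R : realType} {d : measure_display} {W : measurableType d}.
Variable P : probability W R.

Lemma bounded_integrable (Y : W -> R) b : measurable_fun setT Y ->
  (forall w, `|Y w| <= b) -> P.-integrable setT (EFin \o Y).
Proof.
move=> mY Yb; apply: measurable_bounded_integrable => //.
  by rewrite (le_lt_trans (probability_le1 _ _)) ?ltry.
exists b; split; first exact: num_real.
by move=> c bc w _; apply: le_trans (Yb w) _; exact: ltW.
Qed.

Lemma bounded_expectation (Y : W -> R) b : measurable_fun setT Y ->
  (forall w, `|Y w| <= b) -> ('E_P[Y] = (\int[P]_w Y w)%:E)%E.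
Proof.
move=> mY Yb; rewrite unlock /Rintegral fineK//; apply: integrable_fin_num => //.
exact: bounded_integrable Yb.
Qed.

(** Since Y <= 1, it is at most eta plus the indicator of the event Y > eta. *)
Lemma Rintegral_le_outer_prob (Y : W -> R) (eta eps : R) : measurable_fun setT Y ->
  (forall w, 0 <= Y w <= 1) -> 0 <= eta ->
  (outer_prob P [set w | (eta < Y w)%R] <= eps%:E)%E ->
  \int[P]_w Y w <= eta + eps.
Proof.
move=> mY Y01 eta0 Peps.
have Yb w : `|Y w| <= 1 by have /andP[Y0 Y1] := Y01 w; rewrite ger0_norm.
have mD : measurable [set w | eta < Y w].
  rewrite -[X in measurable X]setTI.
  have -> : [set w | eta < Y w] = Y @^-1` `]eta, +oo[.
    by apply/seteqP; split => w /=; rewrite in_itv/= andbT.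
  exact: mY.
rewrite -lee_fin -(bounded_expectation mY Yb) unlock.
apply: (@le_trans _ _ (\int[P]_w (eta%:E + (\1_[set w | (eta < Y w)%R] w)%:E))%E).
  apply: ge0_le_integral => //.
  - by move=> w _; rewrite lee_fin; case/andP: (Y01 w).
  - exact/measurable_EFinP.
  - apply: emeasurable_funD; first exact: measurable_cst.
    by apply/measurable_EFinP; exact: measurable_indic.
  - move=> w _; rewrite -EFinD lee_fin indicE.
    have /andP[Y0 Y1] := Y01 w.
    have [|] := boolP (w \in _); first by rewrite (le_trans Y1)// lerDr.
    by rewrite notin_setE /= => /negP; rewrite -leNgt addr0.
rewrite ge0_integralD//; last first.
  by apply/measurable_EFinP; exact: measurable_indic.
rewrite integral_cst// (_ : eta%:E * _ = eta%:E)%E; last first.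
  by rewrite -[RHS]mule1; congr (_ * _)%E; exact: probability_setT.
rewrite integral_indic// setIT EFinD.
rewrite leeD2l// (le_trans _ Peps)//.
by apply: le_ereal_inf_tmp => _ [D [mE DE] <-]; rewrite le_measure ?inE.
Qed.

End bounded_expectation.

(** * Bounded Lipschitz functionals of paths *)

Section lipschitz_functionals.
Context {R : realType} {I : Type} {n : nat}.
Implicit Types (A : set I) (x y : I -> 'cV[R]_n) (f : (I -> 'cV[R]_n) -> R).

(* For [K = b = 1] this is [BL1] without extended reals; see [BL1P]. *)
Definition lipb A (K b : R) f :=
  (forall x, `|f x| <= b) /\
  forall x y r, (forall i, A i -> enorm (x i - y i) <= r) ->
    `|f x - f y| <= K * r.

(** At infinite distance neither side constrains [f]. An index in [A] makes [supdist] nonnegative,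
    which excludes the value -oo of an empty supremum. *)
Lemma BL1P A f : A !=set0 -> BL1 A f <-> lipb A 1 1 f.
Proof.
move=> [i Ai]; split=> -[fb fL]; split=> // x y.
  move=> r xyr; rewrite mul1r -lee_fin (le_trans (fL x y))//.
  by apply: ge_ereal_sup => _ [j Aj <-]; rewrite lee_fin xyr.
have xy0 : ((enorm (x i - y i))%:E <= supdist A x y)%E.
  by apply: le_ereal_sup_tmp; exists (enorm (x i - y i))%:E => //; exists i.
have : forall j, A j -> ((enorm (x j - y j))%:E <= supdist A x y)%E.
  move=> j Aj; apply: le_ereal_sup_tmp.
  by exists (enorm (x j - y j))%:E => //; exists j.
move: xy0; case: (supdist A x y) => [r| |]//.
- by move=> _ xyr; rewrite lee_fin -[leRHS]mul1r fL.
- by move=> *; rewrite leey.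
Qed.

Lemma le_lipb A K K' b b' f : A !=set0 -> K <= K' -> b <= b' ->
  lipb A K b f -> lipb A K' b' f.
Proof.
move=> [i Ai] KK' bb' [fb fL]; split=> [x|x y r xyr].
  exact: le_trans (fb x) _.
apply: le_trans (fL _ _ _ xyr) _; rewrite ler_wpM2r//.
exact: le_trans (enorm_ge0 _) (xyr i Ai).
Qed.

Lemma lipb_cst A c : lipb A 0 `|c| (fun=> c).
Proof. by split=> // x y r _; rewrite subrr normr0 mul0r. Qed.

Lemma lipbD A K K' b b' f g : lipb A K b f -> lipb A K' b' g ->
  lipb A (K + K') (b + b') (fun x => f x + g x).
Proof.
move=> [fb fL] [gb gL]; split=> [x|x y r xyr].
  by rewrite (le_trans (ler_normD _ _))// lerD.
rewrite opprD addrACA mulrDl (le_trans (ler_normD _ _))// lerD//.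
- exact: fL.
- exact: gL.
Qed.

Lemma lipbZ A K b c f : lipb A K b f ->
  lipb A (`|c| * K) (`|c| * b) (fun x => c * f x).
Proof.
move=> [fb fL]; split=> [x|x y r xyr]; first by rewrite normrM ler_wpM2l.
by rewrite -mulrBr normrM -mulrA ler_wpM2l// fL.
Qed.

(** The common bound [b] keeps the suprema finite, so the common Lipschitz constant survives. The
    modulus and size functionals are built this way. *)
Lemma lipb_sup A K b V (S : set V) (h : V -> (I -> 'cV[R]_n) -> R) :
  S !=set0 -> (forall v, S v -> lipb A K b (h v)) ->
  lipb A K b (fun x => sup [set h v x | v in S]).
Proof.
move=> [v0 Sv0] hK.
have ub x v : S v -> h v x <= sup [set h v x | v in S].
  move=> Sv; apply: ub_le_sup; last by exists v.
  by exists b => _ [u Su <-]; have [/(_ x) /ler_normlP[]] := hK u Su.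
have ne x : [set h v x | v in S] !=set0 by exists (h v0 x), v0.
have half x y r : (forall i, A i -> enorm (x i - y i) <= r) ->
    sup [set h v x | v in S] <= sup [set h v y | v in S] + K * r.
  move=> xyr; apply: ge_sup => // _ [v Sv <-].
  have [_ /(_ _ _ _ xyr) /ler_normlP[_]] := hK v Sv.
  by rewrite lerBlDr addrC => /le_trans; apply; rewrite lerD2r ub.
split=> [x|x y r xyr].
  rewrite ler_norml; apply/andP; split.
    apply: le_trans (ub x v0 Sv0); have [/(_ x) + _] := hK v0 Sv0.
    by rewrite ler_norml => /andP[].
  apply: ge_sup => // _ [v Sv <-]; have [/(_ x) + _] := hK v Sv.
  by rewrite ler_norml => /andP[].
have yxr i : A i -> enorm (y i - x i) <= r by rewrite enorm_distC; exact: xyr.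
rewrite ler_norml; have := half _ _ _ xyr; have := half _ _ _ yxr; lra.
Qed.

Definition clamp (a : R) := Num.min 1 (Num.max 0 a).

Lemma clamp_ge0 a : 0 <= clamp a.
Proof. by rewrite /clamp le_min ler01 le_max lexx. Qed.

Lemma clamp_le1 a : clamp a <= 1.
Proof. by rewrite /clamp ge_min lexx. Qed.

Lemma clamp_norm_le1 a : `|clamp a| <= 1.
Proof. by rewrite ger0_norm ?clamp_ge0// clamp_le1. Qed.

Lemma clamp_lip a b : `|clamp a - clamp b| <= `|a - b|.
Proof.
have H c : [\/ c <= 0 /\ clamp c = 0, 0 <= c <= 1 /\ clamp c = c |
    1 <= c /\ clamp c = 1].
  rewrite /clamp; have [c0|c0] := leP c 0.
    by constructor 1; rewrite min_r.
  have [c1|c1] := leP c 1; first by constructor 2; rewrite ltW.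
  by constructor 3; rewrite ltW.
have := ler_norm (a - b); have := ler_norm (b - a).
rewrite (distrC b a) ler_norml.
by case: (H a) => -[? ->]; case: (H b) => -[? ->]; lra.
Qed.

(* Clamping at 1 makes the suprema below finite on unbounded paths. *)
Definition mod_fun (S : set (I * I)) x : R :=
  sup [set clamp (enorm (x u.1 - x u.2)) | u in S].

Lemma mod_fun_ge S x u : S u -> clamp (enorm (x u.1 - x u.2)) <= mod_fun S x.
Proof.
move=> Su; apply: ub_le_sup; last by exists u.
by exists 1 => _ [v _ <-]; exact: clamp_le1.
Qed.

Lemma mod_fun_bounds S x : S !=set0 -> 0 <= mod_fun S x <= 1.
Proof.
move=> [u Su]; rewrite (le_trans (clamp_ge0 _) (mod_fun_ge x Su))/=.
apply: ge_sup; first by exists (clamp (enorm (x u.1 - x u.2))), u.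
by move=> _ [v _ <-]; exact: clamp_le1.
Qed.

(** The constant is 2 because both endpoints of the increment move. *)
Lemma lipb_clamp_diff A u : A u.1 -> A u.2 ->
  lipb A 2 1 (fun x => clamp (enorm (x u.1 - x u.2))).
Proof.
move=> Au1 Au2; split=> [x|x y r xyr]; first exact: clamp_norm_le1.
rewrite (le_trans (clamp_lip _ _))//.
have H (a b a' b' : 'cV[R]_n) : enorm (a - b) <= enorm (a' - b') +
    (enorm (a - a') + enorm (b - b')).
  rewrite (_ : a - b = (a' - b') + ((a - a') - (b - b'))).
    by rewrite (le_trans (enormD _ _))// lerD2l enormB.
  by apply/colP => i; rewrite !mxE; ring.
have := H (x u.1) (x u.2) (y u.1) (y u.2).
have := H (y u.1) (y u.2) (x u.1) (x u.2).
rewrite !(enorm_distC (y _) (x _)) ler_norml.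
have := xyr _ Au1; have := xyr _ Au2; lra.
Qed.

Lemma lipb_mod_fun A S : S !=set0 -> S `<=` [set u | A u.1 /\ A u.2] ->
  lipb A 2 1 (mod_fun S).
Proof.
by move=> S0 SA; apply: lipb_sup => // u /SA[Au1 Au2]; exact: lipb_clamp_diff.
Qed.

(** A Lipschitz substitute for the indicator of leaving the ball of radius [C]: zero on paths
    bounded by [C], and 1 as soon as some value exceeds C + 1. *)
Definition size_fun A (C : R) x : R := sup [set clamp (enorm (x i) - C) | i in A].

Lemma size_fun_ge A C x i : A i -> clamp (enorm (x i) - C) <= size_fun A C x.
Proof.
move=> Ai; apply: ub_le_sup; last by exists i.
by exists 1 => _ [v _ <-]; exact: clamp_le1.
Qed.

Lemma size_fun_bounds A C x : A !=set0 -> 0 <= size_fun A C x <= 1.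
Proof.
move=> [i Ai]; rewrite (le_trans (clamp_ge0 _) (size_fun_ge C x Ai))/=.
apply: ge_sup; first by exists (clamp (enorm (x i) - C)), i.
by move=> _ [v _ <-]; exact: clamp_le1.
Qed.

Lemma lipb_clamp_size A C i : A i -> lipb A 1 1 (fun x => clamp (enorm (x i) - C)).
Proof.
move=> Ai; split=> [x|x y r xyr]; first exact: clamp_norm_le1.
rewrite (le_trans (clamp_lip _ _))//.
have H (a b : 'cV[R]_n) : enorm a <= enorm b + enorm (a - b).
  by rewrite -{1}[a](subrK b) addrC enormD.
have := H (x i) (y i); have := H (y i) (x i); have := xyr _ Ai.
by rewrite (enorm_distC (y _) (x _)) ler_norml; lra.
Qed.

Lemma lipb_size_fun A C : A !=set0 -> lipb A 1 1 (size_fun A C).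
Proof. by move=> A0; apply: lipb_sup => // i Ai; exact: lipb_clamp_size. Qed.

End lipschitz_functionals.

Lemma lipb_comp {R : realType} {I J : Type} {n m : nat} (A : set I) (A' : set J)
    (K L b : R) (f : (J -> 'cV[R]_m) -> R)
    (Phi : (I -> 'cV[R]_n) -> J -> 'cV[R]_m) :
  (forall x y r, (forall i, A i -> enorm (x i - y i) <= r) ->
    forall j, A' j -> enorm (Phi x j - Phi y j) <= L * r) ->
  lipb A' K b f -> lipb A (K * L) b (f \o Phi).
Proof.
move=> PL [fb fL]; split=> [x|x y r xyr] /=; first exact: fb.
by rewrite -mulrA fL// => j A'j; exact: (PL x y r).
Qed.

(** * The bounded Lipschitz distance tested on rescaled functionals *)

Section weak_convergence.
Context {R : realType} {I : Type} {n : nat}.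
Context {d : measure_display} {W : measurableType d}.
Context {d' : measure_display} {W' : measurableType d'}.
Variables (A : set I) (A0 : A !=set0).

Lemma lipb_normalize K b (f : (I -> 'cV[R]_n) -> R) c : 0 < c -> K <= c ->
  b <= c -> lipb A K b f -> BL1 A (fun x => c^-1 * f x).
Proof.
move=> c0 Kc bc fK; apply/BL1P => //.
apply: le_lipb (lipbZ c^-1 fK) => //.
- by rewrite ger0_norm ?invr_ge0 ?(ltW c0)// mulrC ler_pdivrMr// mul1r.
- by rewrite ger0_norm ?invr_ge0 ?(ltW c0)// mulrC ler_pdivrMr// mul1r.
Qed.

Lemma lipb_measurable (Y : W' -> I -> 'cV[R]_n) K b f : borel_element A Y ->
  lipb A K b f -> measurable_fun setT (fun w => f (Y w)).
Proof.
move=> bY fK; pose c := `|K| + `|b| + 1.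
have c0 : 0 < c by rewrite ltr_wpDl ?addr_ge0.
have /bY : BL1 A (fun x => c^-1 * f x).
  apply: lipb_normalize fK => //.
  - by rewrite (le_trans (ler_norm _))// /c -addrA lerDl addr_ge0.
  - by rewrite (le_trans (ler_norm _))// /c addrAC lerDr addr_ge0.
move=> /(measurable_funM (measurable_cst c)).
by apply: eq_measurable_fun => w _ /=; rewrite mulrA divff ?gt_eqF// mul1r.
Qed.

(** Apply the distance to f / K and scale back, which outer expectation allows for positive factors.
    The two-sided form is convenient for comparison by monotonicity. *)
Lemma BL_dist_lipb (P : probability W R) (X : W -> I -> 'cV[R]_n)
    (Q : probability W' R) (Y : W' -> I -> 'cV[R]_n) K e f :
  borel_element A Y -> 0 < K -> lipb A K K f ->
  (BL_dist A P X Q Y <= e%:E)%E ->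
  ((\int[Q]_w f (Y w) - K * e)%:E <= outer_expectation P (fun w => (f (X w))%:E)
   <= (\int[Q]_w f (Y w) + K * e)%:E)%E.
Proof.
move=> bY K0 fK Xe.
pose f1 := fun x => K^-1 * f x.
have f1BL : BL1 A f1 by exact: lipb_normalize fK.
have mf1 := bY _ f1BL.
have f1b w : `|f1 (Y w)| <= 1 by have [] := f1BL.
have fE x : f x = K * f1 x by rewrite /f1 mulrA divff ?gt_eqF// mul1r.
have -> : \int[Q]_w f (Y w) = K * \int[Q]_w f1 (Y w).
  under eq_Rintegral do rewrite fE.
  by rewrite RintegralZl//; exact: bounded_integrable f1b.
have -> : (fun w => (f (X w))%:E) = (fun w => K%:E * (f1 (X w))%:E)%E.
  by apply/funext => w; rewrite -EFinM -fE.
rewrite outer_expectationZ// -mulrBr -mulrDr !EFinM !lee_pmul2l//.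
have : (`|outer_expectation P (fun w => (f1 (X w))%:E)
          - 'E_Q[fun w => f1 (Y w)]| <= e%:E)%E.
  apply: le_trans Xe; apply: le_ereal_sup_tmp; eexists; last exact: lexx.
  by exists f1.
rewrite (bounded_expectation Q mf1 f1b).
case: outer_expectation => [a| |]//=.
by rewrite !lee_fin ler_norml; lra.
Qed.

End weak_convergence.

(** * Linear functionals of Gaussian processes and their covariances *)

Section linear_expectation.
Context {R : realType} {d : measure_display} {W : measurableType d}.
Variable Q : probability W R.

Lemma expectation_integrable (X : W -> R) (c : R) : measurable_fun setT X ->
  ('E_Q[X] = c%:E)%E -> Q.-integrable setT (EFin \o X).
Proof.
move=> mX EX; apply/integrableP; split; first exact/measurable_EFinP.
by rewrite integral_fin_num_abs//; move: EX; rewrite unlock => ->.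
Qed.

Lemma expectation_lincomb (J : finType) (X : J -> W -> R) (c mu : J -> R) :
  (forall i, measurable_fun setT (X i)) ->
  (forall i, 'E_Q[X i] = (mu i)%:E)%E ->
  ('E_Q[fun w => (\sum_i c i * X i w)%R] = (\sum_i c i * mu i)%:E)%E.
Proof.
move=> mX EX; have iX i := expectation_integrable (mX i) (EX i).
rewrite unlock; under eq_integral do rewrite -sumEFin.
rewrite integral_sum//; last first.
  by move=> i; under eq_fun do rewrite EFinM; apply: integrableZl => //; exact: iX.
rewrite -sumEFin; apply: eq_bigr => i _.
under eq_integral do rewrite EFinM.
rewrite integralZl//; last exact: iX.
by have := EX i; rewrite unlock EFinM => ->.
Qed.

End linear_expectation.

Section gaussian_linear.
Context {R : realType} {d : measure_display} {W : measurableType d}.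
Context {I : Type} {n : nat}.
Variables (Q : probability W R) (A : set I) (X : W -> I -> 'cV[R]_n).
Variable K : I -> I -> 'M[R]_n.
Hypothesis XG : mean_zero_gaussian_process Q A X K.

Lemma gaussian_dot_measurable s a : A s ->
  measurable_fun setT (fun w => dot a (X w s)).
Proof.
move=> As; have [[mX _] _ _] := XG.
have -> : (fun w => dot a (X w s)) = (fun w => \sum_i a i 0 * X w s i 0).
  by apply/funext => w; rewrite /dot mxE; apply: eq_bigr => i _; rewrite mxE.
apply: measurable_sum => i.
by apply: measurable_funM; [exact: measurable_cst|exact: mX].
Qed.

Lemma gaussian_dot_mean s a : A s -> ('E_Q[fun w => dot a (X w s)] = 0)%E.
Proof.
move=> As; have [[mX _] X0 _] := XG.
have -> : (fun w => dot a (X w s)) = (fun w => \sum_i a i 0 * X w s i 0).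
  by apply/funext => w; rewrite /dot mxE; apply: eq_bigr => i _; rewrite mxE.
rewrite (@expectation_lincomb _ _ _ _ _ (fun i w => X w s i 0) _ (fun=> 0))//.
- by rewrite big1// => i _; rewrite mulr0.
- by move=> i; exact: mX.
- by move=> i; exact: X0.
Qed.

Lemma gaussian_dot_covariance s t a b : A s -> A t ->
  ('E_Q[fun w => (dot a (X w s) * dot b (X w t))%R]
   = (dot a (K s t *m b))%:E)%E.
Proof.
move=> As At; have [[mX _] _ XK] := XG.
have dotE (x y u v : 'cV[R]_n) : dot x y * dot u v =
    \sum_(r : 'I_n * 'I_n) (x r.1 0 * u r.2 0) * (y r.1 0 * v r.2 0).
  rewrite /dot !mxE mulr_suml -(pair_bigA _ (fun i j =>
    (x i 0 * u j 0) * (y i 0 * v j 0)))/=.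
  apply: eq_bigr => i _; rewrite mulr_sumr; apply: eq_bigr => j _.
  by rewrite !mxE mulrACA.
have -> : (fun w => dot a (X w s) * dot b (X w t)) =
    (fun w => \sum_(r : 'I_n * 'I_n) (a r.1 0 * b r.2 0) *
       (X w s r.1 0 * X w t r.2 0)) by apply/funext => w; exact: dotE.
rewrite (@expectation_lincomb _ _ _ _ _
  (fun (r : 'I_n * 'I_n) w => X w s r.1 0 * X w t r.2 0) _
  (fun r => K s t r.1 r.2)).
- congr (_%:E); rewrite /dot mxE -(pair_bigA _ (fun i j =>
    (a i 0 * b j 0) * K s t i j))/=.
  apply: eq_bigr => i _; rewrite !mxE mulr_sumr; apply: eq_bigr => j _.
  by rewrite mulrAC mulrA.
- by move=> r; apply: measurable_funM; exact: mX.
- by move=> r; exact: XK.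
Qed.

Lemma gaussian_covariance_sym s t : A s -> A t -> (K s t)^T = K t s.
Proof.
move=> As At; have [_ _ XK] := XG.
apply/matrixP => i j; rewrite mxE; apply: EFin_inj.
by rewrite -XK// -XK//; congr expectation; apply/funext => w; rewrite mulrC.
Qed.

Lemma gaussian_covariance_le s t a b : A s -> A t ->
  dot a (K s t *m b) <= (dot a (K s s *m a) + dot b (K t t *m b)) / 2.
Proof.
move=> As At.
have ms := gaussian_dot_measurable a As; have mt := gaussian_dot_measurable b At.
have Est := gaussian_dot_covariance a b As At.
have mst := measurable_funM ms mt.
(* The half sum of the two squares is indexed by [bool] so that [expectation_lincomb] computes its
   mean. *)
pose Y (c : bool) w := if c then dot a (X w s) * dot a (X w s)
                       else dot b (X w t) * dot b (X w t).
have mY c : measurable_fun setT (Y c) by case: c; exact: measurable_funM.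
have EY := @expectation_lincomb _ _ _ Q _ Y (fun=> 2^-1)
  (fun c => if c then dot a (K s s *m a) else dot b (K t t *m b)) mY.
have {}EY : ('E_Q[fun w => (\sum_c 2^-1 * Y c w)%R]
  = ((dot a (K s s *m a) + dot b (K t t *m b)) / 2)%:E)%E.
  rewrite EY; first by rewrite big_bool /= -mulrDr mulrC.
  by case; exact: gaussian_dot_covariance.
have mS : measurable_fun setT (fun w => \sum_c 2^-1 * Y c w).
  by apply: measurable_sum => c; apply: measurable_funM.
have := le_Rintegral measurableT (expectation_integrable mst Est)
  (expectation_integrable mS EY).
move: Est EY; rewrite unlock /Rintegral => -> -> /=; apply => w _.
rewrite big_bool /Y /=; set u := dot a _; set v := dot b _.
by have := sqr_ge0 (u - v); rewrite expr2; lra.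
Qed.

(** For unit vectors [gaussian_covariance_le] bounds the bilinear form by (c + c) / 2; the general
    case follows by normalising x and y. *)
Lemma gaussian_covariance_opnorm s t c : A s -> A t -> 0 <= c ->
  (forall x, dot x (K s s *m x) <= c * dot x x) ->
  (forall x, dot x (K t t *m x) <= c * dot x x) ->
  opnorm (K s t) <= c.
Proof.
move=> As At c0 Kss Ktt; apply: opnorm_le_dot => // x y.
have [->|x0] := eqVneq x 0.
  by rewrite dotC {1}/dot mulmx0 mxE enorm0 mulr0 mul0r.
have [->|y0] := eqVneq y 0.
  by rewrite mulmx0 {1}/dot mulmx0 mxE enorm0 mulr0.
have unit (z : 'cV[R]_n) : z != 0 ->
    dot ((enorm z)^-1 *: z) ((enorm z)^-1 *: z) = 1.
  by move=> z0; rewrite dotZl dotZr mulrA -expr2 exprVn enorm_sq mulVf ?dotxx_eq0.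
have pos (z : 'cV[R]_n) : z != 0 -> 0 < enorm z.
  by move=> z0; rewrite lt_neqAle eq_sym enorm_eq0 z0 enorm_ge0.
have := gaussian_covariance_le ((enorm x)^-1 *: x) ((enorm y)^-1 *: y) As At.
have := Kss ((enorm x)^-1 *: x); have := Ktt ((enorm y)^-1 *: y).
rewrite !unit// mulr1 => kt ks.
rewrite -scalemxAr dotZl dotZr => kst.
have : (enorm x)^-1 * ((enorm y)^-1 * dot x (K s t *m y)) <= c by lra.
rewrite ler_pdivrMl ?pos// ler_pdivrMl ?pos//.
by rewrite (_ : enorm y * _ = c * enorm x * enorm y)//; ring.
Qed.

End gaussian_linear.

(** A linear combination of the values L(j) X(phi(j)) with coefficients c is one of values of X with
    coefficients L(j)^T c. It is used with phi(t) = (beta(t), t) and L(t) = (I, M_T(t)), giving the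
    limit in (1). *)
Lemma gaussian_transform {R : realType} {d : measure_display}
    {W : measurableType d} {I J : Type} {m n : nat} (Q : probability W R)
    (A : set I) (A' : set J) (X : W -> I -> 'cV[R]_n) K
    (phi : J -> I) (L : J -> 'M[R]_(m, n)) :
  (forall j, A' j -> A (phi j)) ->
  mean_zero_gaussian_process Q A X K ->
  mean_zero_gaussian_process Q A' (fun w j => L j *m X w (phi j))
    (fun s t => L s *m K (phi s) (phi t) *m (L t)^T).
Proof.
move=> phiA XG; have [[mX Xlaw] _ _] := XG.
have rowE j i w : (L j *m X w (phi j)) i 0 = dot (row i (L j))^T (X w (phi j)).
  by rewrite /dot trmxK -row_mul [RHS]mxE.
split; first split.
- move=> s A's i; under eq_fun do rewrite rowE.
  by apply: (gaussian_dot_measurable XG); exact: phiA.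
- move=> N t c A't.
  have [|mu [s lawE]] := Xlaw N (phi \o t) (fun l => (L (t l))^T *m c l).
    by move=> l; exact/phiA.
  exists mu, s => D mD; rewrite -lawE//; congr (Q _).
  apply/funext => w /=; congr (D (fun_of_matrix _ 0 0)).
  by apply: eq_bigr => l _; rewrite trmx_mul trmxK mulmxA.
- move=> s A's i; under eq_fun do rewrite rowE.
  by apply: (gaussian_dot_mean XG); exact: phiA.
- move=> s t A's A't i j.
  under eq_fun do rewrite !rowE.
  rewrite (gaussian_dot_covariance XG); [|exact: phiA|exact: phiA].
  congr (_%:E); rewrite /dot trmxK tr_row mulmxA -row_mul [LHS]mxE [RHS]mxE.
  by apply: eq_bigr => l _; rewrite [row _ _ _ _]mxE [col _ _ _ _]mxE.
Qed.

(** * Replacing beta-hat by beta: paths, outer expectations, covariances *)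

Section concentration.
Context {R : realType}.

Lemma enorm_row1_mx_le k p (M : 'M[R]_(k, p)) Mb x : opnorm M <= Mb ->
  enorm (row_mx 1%:M M *m x) <= (1 + Mb) * enorm x.
Proof.
move=> Mle; rewrite (le_trans (enorm_mulmx _ _))// ler_wpM2r ?enorm_ge0//.
by rewrite (le_trans (opnorm_row_mx _))// lerD2l.
Qed.

(** Pathwise form of the error bound. If a functional reaches 1, the right side is at least 2 and
    |f| <= 1 suffices. Otherwise the clamps are inactive: the path is bounded by C + 1, so betahat
    is within [del] of beta, and both the modulus and the expansion apply. *)
Lemma concentration_path k p q (B : set 'cV[R]_p) (Theta : set 'cV[R]_q)
    (g m : 'cV[R]_p -> 'cV[R]_q -> 'cV[R]_k) (b bh : 'cV[R]_q -> 'cV[R]_p)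
    (M : 'cV[R]_q -> 'M[R]_(k, p)) (s C del r : R)
    (f : ('cV[R]_q -> 'cV[R]_k) -> R)
    (A := B `*` Theta)
    (S := [set u : ('cV[R]_p * 'cV[R]_q) * ('cV[R]_p * 'cV[R]_q) |
       [/\ A u.1, A u.2 &
         enorm (col_mx (u.1.1 - u.2.1) (u.1.2 - u.2.2)) < del]])
    (x := fun z : 'cV[R]_p * 'cV[R]_q =>
       col_mx (g z.1 z.2 - m z.1 z.2) (s *: (bh z.2 - b z.2))) :
  Theta !=set0 -> BL1 Theta f -> 0 < s -> 0 < del -> C + 1 < s * del ->
  (forall t, Theta t -> B (b t)) -> (forall t, Theta t -> B (bh t)) ->
  (forall t, Theta t -> s * enorm (bh t - b t) <= C + 1 ->
     enorm (m (bh t) t - m (b t) t - M t *m (s *: (bh t - b t))) <= r) ->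
  0 <= r ->
  `|f (fun t => g (bh t) t - m (b t) t) -
    f (fun t => row_mx 1%:M (M t) *m x (b t, t))| <=
  2 * mod_fun S x + 2 * size_fun A C x + r.
Proof.
move=> T0 fBL s0 del0 Cs Bb Bbh mM r0.
have [t0 Tt0] := T0.
have [fb fL] := (BL1P f T0).1 fBL.
have A0 : A (b t0, t0) by split => //=; exact: Bb.
have Hge z : A z -> clamp (enorm (x z) - C) <= size_fun A C x.
  exact: size_fun_ge.
have S0 : S ((b t0, t0), (b t0, t0)).
  by split => //=; rewrite !subrr col_mx0 enorm0.
have F0 := le_trans (clamp_ge0 _) (mod_fun_ge x S0).
have H0 := le_trans (clamp_ge0 _) (Hge _ A0).
have two : `|f (fun t => g (bh t) t - m (b t) t) -
    f (fun t => row_mx 1%:M (M t) *m x (b t, t))| <= 2.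
  by rewrite (le_trans (ler_normB _ _))// (le_trans (lerD (fb _) (fb _)))//; lra.
have [H1|H1] := leP 1 (size_fun A C x); first by lra.
have [F1|F1] := leP 1 (mod_fun S x); first by lra.
have clampE (a e : R) : 0 <= a -> clamp a <= e -> e < 1 -> a <= e.
  rewrite /clamp => a0; rewrite (max_idPr a0) ge_min => /orP[|//] /le_lt_trans h.
  by move/h; rewrite ltxx.
have xC z : A z -> enorm (x z) <= C + 1.
  move=> /Hge xz; rewrite -lerBlDl.
  have [n0|n0] := leP 0 (enorm (x z) - C); last by lra.
  by have := clampE _ _ n0 xz H1; lra.
suff : `|f (fun t => g (bh t) t - m (b t) t) -
    f (fun t => row_mx 1%:M (M t) *m x (b t, t))| <= 1 * (mod_fun S x + r).
  by move=> /le_trans; apply; lra.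
apply: fL => t Tt.
have Ab : A (b t, t) by split => //=; exact: Bb.
have Abh : A (bh t, t) by split => //=; exact: Bbh.
have near_b : s * enorm (bh t - b t) <= C + 1.
  apply: le_trans (xC _ Ab); rewrite -[s in leLHS]gtr0_norm// -enormZ.
  exact: enorm_col_mx_down.
have St : S ((bh t, t), (b t, t)).
  split => //=; rewrite subrr enorm_col_mx0.
  by rewrite -(ltr_pM2l s0) (le_lt_trans near_b).
rewrite /x /= mul_row_col mul1mx.
have -> : g (bh t) t - m (b t) t -
    (g (b t) t - m (b t) t + M t *m (s *: (bh t - b t))) =
    ((g (bh t) t - m (bh t) t) - (g (b t) t - m (b t) t)) +
    (m (bh t) t - m (b t) t - M t *m (s *: (bh t - b t))).
  by apply/colP => i; rewrite !mxE; ring.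
rewrite (le_trans (enormD _ _))// lerD ?mM//.
apply: le_trans (clampE _ _ (enorm_ge0 _) (mod_fun_ge x St) F1).
by rewrite /x /= opp_col_mx add_col_mx enorm_col_mx_up.
Qed.

(** Without additivity, [h] is squeezed between f - phi and f + phi evaluated at X. Both have
    Lipschitz constant and bound K + K', and in the limit everything is measurable, so there the
    integrals do split. *)
Lemma outer_expectation_sandwich {I : Type} {n : nat} {d : measure_display}
    {W : measurableType d} {d' : measure_display} {W' : measurableType d'}
    (A : set I) (P : probability W R) (X : W -> I -> 'cV[R]_n)
    (Q : probability W' R) (Y : W' -> I -> 'cV[R]_n)
    (K K' e : R) (f phi : (I -> 'cV[R]_n) -> R) (h : W -> R) :
  A !=set0 -> borel_element A Y -> 0 < K -> 0 < K' ->
  lipb A K K f -> lipb A K' K' phi ->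
  (forall w, `|h w - f (X w)| <= phi (X w)) ->
  (BL_dist A P X Q Y <= e%:E)%E ->
  (`|outer_expectation P (fun w => (h w)%:E) - 'E_Q[fun w => f (Y w)]|
   <= (\int[Q]_w phi (Y w) + (K + K') * e)%:E)%E.
Proof.
move=> A0 bY K0 K'0 fK phiK hf Xe.
have mf := lipb_measurable A0 bY fK; have mphi := lipb_measurable A0 bY phiK.
have ff : Q.-integrable setT (EFin \o (fun w => f (Y w))).
  by apply: (bounded_integrable Q (b := K)) => // w; exact: fK.1.
have fphi : Q.-integrable setT (EFin \o (fun w => phi (Y w))).
  by apply: (bounded_integrable Q (b := K')) => // w; exact: phiK.1.
rewrite (@bounded_expectation _ _ _ _ _ K mf); last by move=> w; exact: fK.1.
have KK0 : 0 < K + K' by exact: addr_gt0.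
have := BL_dist_lipb A0 bY KK0 (lipbD fK phiK) Xe.
rewrite RintegralD// => /andP[_ up].
have nphiK : lipb A (K + K') (K + K') (fun x => f x + -1 * phi x).
  have := lipbD fK (lipbZ (-1) phiK).
  by rewrite normrN1 !mul1r.
have := BL_dist_lipb A0 bY KK0 nphiK Xe.
rewrite RintegralD//; last first.
  rewrite [X in integrable _ _ X](_ : _ = fun w => (-1)%:E * (phi (Y w))%:E)%E//.
  exact: integrableZl.
rewrite RintegralZl// mulN1r => /andP[lo _].
have {}up := le_trans (le_outer_expectation P (h := fun w => (h w)%:E) (fun w =>
  (_ : (h w)%:E <= (f (X w) + phi (X w))%:E)%E)) up.
have {}lo := le_trans lo (le_outer_expectation P (h' := fun w => (h w)%:E) (fun w =>
  (_ : (f (X w) + -1 * phi (X w))%:E <= (h w)%:E)%E)).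
have {}up : (outer_expectation P (fun w => (h w)%:E) <=
    (\int[Q]_w f (Y w) + \int[Q]_w phi (Y w) + (K + K') * e)%:E)%E.
  apply: up => w; rewrite lee_fin; have := hf w; rewrite ler_norml; lra.
have {}lo : ((\int[Q]_w f (Y w) - \int[Q]_w phi (Y w) - (K + K') * e)%:E <=
    outer_expectation P (fun w => (h w)%:E))%E.
  apply: lo => w; rewrite lee_fin; have := hf w; rewrite ler_norml; lra.
move: up lo; case: outer_expectation => [a| |]//=.
by rewrite !lee_fin ler_norml; lra.
Qed.

Lemma concentrated_cov_dist k p q (M Mh : 'cV[R]_q -> 'M[R]_(k, p)) S Sh b bh
    s t (eta eta' lam Mb : R) :
  0 <= eta -> 0 <= eta' -> 0 <= lam -> 0 <= Mb ->
  (forall u, u = s \/ u = t -> opnorm (M u) <= Mb /\ opnorm (Mh u - M u) <= eta) ->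
  opnorm (S (b s) s (b t) t) <= lam ->
  opnorm (Sh (bh s) s (bh t) t - S (b s) s (b t) t) <= eta' ->
  opnorm (concentrated_cov Mh Sh bh s t - concentrated_cov M S b s t) <=
    eta * (lam + eta') * (1 + Mb + eta) + (1 + Mb) * eta' * (1 + Mb + eta) +
    (1 + Mb) * lam * eta.
Proof.
move=> eta0 eta'0 lam0 Mb0 MM; rewrite /concentrated_cov.
have [Ms Mhs] := MM s (or_introl erefl); have [Mt Mht] := MM t (or_intror erefl).
move: (S _ _ _ _) (Sh _ _ _ _) => V Vh Vlam dV.
have LhE u : row_mx (1%:M : 'M[R]_k) (Mh u) =
    row_mx 1%:M (M u) + row_mx 0 (Mh u - M u).
  by rewrite add_row_mx addr0 addrC subrK.
rewrite !LhE; set Ls := row_mx _ (M s); set Lt := row_mx _ (M t).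
set Ds := row_mx _ (Mh s - _); set Dt := row_mx _ (Mh t - _).
have nDs : opnorm Ds <= eta by exact: le_trans (opnorm_row0_mx _) _.
have nDt : opnorm Dt^T <= eta.
  by apply: le_trans (opnorm_tr _) _; exact: le_trans (opnorm_row0_mx _) _.
have nLs : opnorm Ls <= 1 + Mb by rewrite (le_trans (opnorm_row_mx _))// lerD2l.
have nLt : opnorm Lt^T <= 1 + Mb.
  by rewrite (le_trans (opnorm_tr _))// (le_trans (opnorm_row_mx _))// lerD2l.
have nVh : opnorm Vh <= lam + eta'.
  by rewrite -(subrK V Vh) addrC (le_trans (opnormD _ _))// lerD.
have nLDt : opnorm (Lt + Dt)^T <= 1 + Mb + eta.
  by rewrite linearD /= (le_trans (opnormD _ _))// lerD.
(* Telescoping: the three factors are exchanged one at a time, which yields the three terms of the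
   bound. *)
have -> : (Ls + Ds) *m Vh *m (Lt + Dt)^T - Ls *m V *m Lt^T =
    Ds *m Vh *m (Lt + Dt)^T + Ls *m (Vh - V) *m (Lt + Dt)^T + Ls *m V *m Dt^T.
  rewrite [(Lt + Dt)^T]linearD /= !(mulmxDl, mulmxDr, mulmxN, mulNmx).
  move: (Ls *m Vh *m Lt^T) (Ds *m Vh *m Lt^T) (Ls *m Vh *m Dt^T)
    (Ds *m Vh *m Dt^T) (Ls *m V *m Lt^T) (Ls *m V *m Dt^T) => *.
  by apply/matrixP => i j; rewrite !mxE; ring.
have M3 a1 a2 a3 (X1 : 'M[R]_(k, k + p)) (X2 : 'M[R]_(k + p)) (X3 : 'M[R]_(k + p, k)) :
    opnorm X1 <= a1 -> opnorm X2 <= a2 -> opnorm X3 <= a3 ->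
    opnorm (X1 *m X2 *m X3) <= a1 * a2 * a3.
  move=> h1 h2 h3; rewrite (le_trans (opnormM _ _))// ler_pM ?opnorm_ge0//.
  by rewrite (le_trans (opnormM _ _))// ler_pM ?opnorm_ge0.
rewrite (le_trans (opnormD _ _))// lerD ?M3//.
by rewrite (le_trans (opnormD _ _))// lerD ?M3.
Qed.

End concentration.

(** * Extended real limits and suprema *)

Section limits.
Context {R : realType}.
Local Open Scope ereal_scope.

Lemma cvge0_near_le (u : nat -> \bar R) (e : R) : u @ \oo --> 0 -> (0 < e)%R ->
  \forall T \near \oo, u T <= e%:E.
Proof.
move=> /(fine_cvgP u 0)[ufin /cvgrPdist_le u0] e0.
near=> T.
have Tf : u T \is a fin_num by near: T.
rewrite -(fineK Tf) lee_fin.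
have : (`|0 - fine (u T)| <= e)%R by near: T; exact: u0.
by rewrite sub0r normrN => /(le_trans (ler_norm _)).
Unshelve. all: by end_near. Qed.

Lemma cvge0_of_near (u : nat -> \bar R) :
  (forall e : R, (0 < e)%R -> \forall T \near \oo, 0 <= u T <= e%:E) ->
  u @ \oo --> 0.
Proof.
move=> ue; apply/(fine_cvgP u 0); split.
  near=> T; have /andP[u0 u1] : 0 <= u T <= 1%:E by near: T; exact: ue.
  by rewrite ge0_fin_numE// (le_lt_trans u1) ?ltry.
apply/cvgrPdist_le => e e0; near=> T.
have /andP[u0 u1] : 0 <= u T <= e%:E by near: T; exact: ue.
rewrite sub0r normrN /= ger0_norm ?fine_ge0// -lee_fin fineK//.
by rewrite ge0_fin_numE// (le_lt_trans u1) ?ltry.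
Unshelve. all: by end_near. Qed.

Lemma near_le_sqrt (c : R) : \forall T \near \oo, (c <= Num.sqrt T%:R)%R.
Proof.
near=> T.
rewrite (le_trans (ler_norm _))// -sqrtr_sqr ler_wsqrtr//.
by near: T; exact: nbhs_infty_ger.
Unshelve. all: by end_near. Qed.

End limits.

Section suprema.
Context {R : realType}.
Local Open Scope ereal_scope.

Lemma usup_leP {I : Type} (A : set I) (F : I -> \bar R) y :
  \usup_(x in A) F x <= y <-> (forall x, A x -> F x <= y).
Proof.
split=> [/ereal_supP Fy x Ax|Fy]; first by apply: Fy; exists x.
by apply: ge_ereal_sup => _ [x Ax <-]; exact: Fy.
Qed.

Lemma uinf_geP {I : Type} (A : set I) (F : I -> \bar R) y :
  y <= \uinf_(x in A) F x <-> (forall x, A x -> y <= F x).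
Proof.
split=> [/ereal_infP Fy x Ax|Fy]; first by apply: Fy; exists x.
by apply: le_ereal_inf_tmp => _ [x Ax <-]; exact: Fy.
Qed.

Lemma le_usup {I : Type} (A : set I) (F : I -> \bar R) x y :
  A x -> y <= F x -> y <= \usup_(x in A) F x.
Proof. by move=> Ax yF; apply: le_ereal_sup_tmp; exists (F x) => //; exists x. Qed.

Lemma ge_uinf {I : Type} (A : set I) (F : I -> \bar R) x y :
  A x -> F x <= y -> \uinf_(x in A) F x <= y.
Proof. by move=> Ax Fy; apply: ge_ereal_inf; exists (F x) => //; exists x. Qed.

End suprema.

(** * Equicontinuity and tightness of the limit in terms of functionals *)

Section gaussian_functionals.
Context {R : realType} {I : Type} {n : nat}.
Context {d : measure_display} {W : measurableType d}.
Variables (Q : probability W R) (A : set I) (Y : W -> I -> 'cV[R]_n).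
Hypotheses (A0 : A !=set0) (bY : borel_element A Y).

(** Clamping only lowers the increments, so [mod_fun] can exceed [eta] only where the true modulus
    does. *)
Lemma Rintegral_mod_fun S eta eps : S !=set0 ->
  S `<=` [set u | A u.1 /\ A u.2] -> 0 <= eta ->
  (outer_prob Q [set w | eta%:E <
     \usup_(u in S) (enorm (Y w u.1 - Y w u.2))%:E] <= eps%:E)%E ->
  \int[Q]_w mod_fun S (Y w) <= eta + eps.
Proof.
move=> S0 SA eta0 Qeps; have SL : lipb A 2 1 (@mod_fun R I n S) := lipb_mod_fun S0 SA.
have mS := lipb_measurable A0 bY SL.
apply: Rintegral_le_outer_prob => //.
  by move=> w; exact: mod_fun_bounds.
apply: le_trans Qeps; apply: le_outer_prob => w /=; apply: contraPT.
rewrite -leNgt => /usup_leP Yeta /=; apply/negP; rewrite -leNgt.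
have [u Su] := S0; apply: ge_sup; first by exists (clamp (enorm (Y w u.1 - Y w u.2))), u.
move=> _ [v Sv <-]; have := Yeta v Sv; rewrite lee_fin; apply: le_trans.
by rewrite /clamp (max_idPr (enorm_ge0 _)) ge_min lexx orbT.
Qed.

Lemma Rintegral_size_fun C eps :
  (outer_prob Q [set w | C%:E < \usup_(z in A) (enorm (Y w z))%:E]
    <= eps%:E)%E ->
  \int[Q]_w size_fun A C (Y w) <= eps.
Proof.
move=> Qeps; have SL : lipb A 1 1 (@size_fun R I n A C) := lipb_size_fun C A0.
(* Threshold 0: [size_fun] is positive only on paths that exceed [C]. *)
have [i Ai] := A0; rewrite -[leRHS]add0r.
have mS := lipb_measurable A0 bY SL.
apply: Rintegral_le_outer_prob => //.
  by move=> w; exact: size_fun_bounds.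
apply: le_trans Qeps; apply: le_outer_prob => w /=; apply: contraPT.
rewrite -leNgt => /usup_leP YC /=; apply/negP; rewrite -leNgt.
apply: ge_sup; first by exists (clamp (enorm (Y w i) - C)), i.
move=> _ [v Av <-]; have := YC v Av; rewrite lee_fin -subr_le0 => vC.
by rewrite /clamp (max_idPl vC) ge_min lexx orbT.
Qed.

(** Tightness passes from the limit to the sample process: [size_fun] is at least 1 on the event,
    and its mean is small in the limit. The unit gap between C and C + 1 leaves room for a Lipschitz
    functional. *)
Lemma outer_prob_size {d' : measure_display} {W' : measurableType d'}
    (P : probability W' R) (X : W' -> I -> 'cV[R]_n) C eps e :
  (outer_prob Q [set w | C%:E < \usup_(z in A) (enorm (Y w z))%:E]
    <= eps%:E)%E ->
  (BL_dist A P X Q Y <= e%:E)%E ->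
  (outer_prob P [set w | exists2 z, A z & (C + 1 < enorm (X w z))%R]
    <= (eps + e)%:E)%E.
Proof.
move=> QC Xe; have SL : lipb A 1 1 (@size_fun R I n A C) := lipb_size_fun C A0.
have /andP[_] := BL_dist_lipb A0 bY ltr01 SL Xe.
have := Rintegral_size_fun QC; rewrite mul1r => Ile Ele.
apply: le_trans (_ : _ <= outer_expectation P (fun w => (size_fun A C (X w))%:E))%E _.
  have size0 w : (0 <= (size_fun A C (X w))%:E)%E.
    by rewrite lee_fin; case/andP: (size_fun_bounds C (X w) A0).
  apply: le_trans (outer_prob_le_expectation P size0).
  apply: le_outer_prob => w /= [z Az Cz]; rewrite lee_fin.
  apply: le_trans (size_fun_ge C (X w) Az); rewrite /clamp le_min lexx /= le_max.
  by apply/orP; right; lra.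
by apply: le_trans Ele _; rewrite lee_fin lerD2r.
Qed.

End gaussian_functionals.

Lemma BL_dist_ge0 {R : realType} {I : Type} {n : nat} {d : measure_display}
    {W : measurableType d} {d' : measure_display} {W' : measurableType d'}
    (A : set I) (P : probability W R) (X : W -> I -> 'cV[R]_n)
    (Q : probability W' R) (Y : W' -> I -> 'cV[R]_n) :
  A !=set0 -> (0 <= BL_dist A P X Q Y)%E.
Proof.
move=> A0; apply: (@le_usup _ _ _ _ (fun=> 0)); last exact: abse_ge0.
apply/BL1P => //; apply: le_lipb (lipb_cst A 0) => //.
by rewrite normr0.
Qed.

(** With L = (I, M), the form of V at x is that of S at L^T x. The identity block gives |L^T x| >=
    |x|, and |L^T x| <= (1 + Mb) |x|. The lower bound is weakened so that one constant serves both
    ends. *)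
Lemma congruence_lambda {R : realType} k p (M : 'M[R]_(k, p))
    (S : 'M[R]_(k + p)) (lam Mb : R)
    (V := row_mx 1%:M M *m S *m (row_mx 1%:M M)^T) :
  (0 < k)%N -> S^T = S -> 0 < lam -> opnorm M <= Mb ->
  lam^-1 <= lambda_min S -> lambda_max S <= lam ->
  [/\ (lam * (1 + Mb) ^+ 2)^-1 <= lambda_min V,
      lambda_min V <= lambda_max V & lambda_max V <= lam * (1 + Mb) ^+ 2].
Proof.
move=> k0 Ssym lam0 MMb Smin Smax.
have Mb0 : 0 <= Mb by exact: le_trans (opnorm_ge0 _) MMb.
have Mb1 : 0 < 1 + Mb by rewrite ltr_wpDr.
have kp0 : (0 < k + p)%N by rewrite addn_gt0 k0.
have Vsym : V^T = V by rewrite /V trmx_mul trmxK trmx_mul Ssym mulmxA.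
set L := row_mx 1%:M M in V Vsym *.
have VE x : dot x (V *m x) = dot (L^T *m x) (S *m (L^T *m x)).
  by rewrite /V -!mulmxA dot_mulmx.
have Lge x : dot x x <= dot (L^T *m x) (L^T *m x).
  rewrite /L tr_row_mx trmx1 mul_col_mx mul1mx dot_col_mx lerDl.
  exact: dotxx_ge0.
have Lle x : dot (L^T *m x) (L^T *m x) <= (1 + Mb) ^+ 2 * dot x x.
  rewrite -enorm_le ?addr_ge0// (le_trans (enorm_mulmx _ _))//.
  rewrite ler_wpM2r ?enorm_ge0// (le_trans (opnorm_tr _))//.
  by rewrite (le_trans (opnorm_row_mx _))// lerD2l.
split; [apply: lambda_min_ge => // x| exact: lambda_min_le_max|
  apply: lambda_max_le => // x]; rewrite VE.
- apply: le_trans (lambda_min_le_dot _ kp0 Ssym).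
  apply: (@le_trans _ _ (lam^-1 * dot x x)).
    rewrite ler_wpM2r ?dotxx_ge0// lef_pV2 ?posrE ?mulr_gt0 ?exprn_gt0//.
    by rewrite (ler_peMr (ltW lam0))// exprn_ege1// lerDl.
  apply: ler_pM => //; [by rewrite invr_ge0 ltW|exact: dotxx_ge0].
- apply: le_trans (dot_le_lambda_max _ kp0 Ssym) _.
  apply: (@le_trans _ _ (lam * dot (L^T *m x) (L^T *m x))).
    by rewrite ler_wpM2r ?dotxx_ge0.
  by rewrite -mulrA ler_wpM2l ?(ltW lam0)// Lle.
Qed.

(** * The three conclusions *)

Local Open Scope ereal_scope.

Theorem theorem3 (R : realType) (k p q : nat) (k_gt0 : (0 < k)%N)
  (* parameter spaces *)
  (B : set 'cV[R]_p) (Theta : set 'cV[R]_q)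
  (theta0 : 'cV[R]_q) (theta0_in : Theta theta0)
  (* sample space of the data, and the class of data distributions *)
  (d : measure_display) (W : measurableType d) (P0 : set (probability W R))
  (g : nat -> W -> 'cV[R]_p -> 'cV[R]_q -> 'cV[R]_k)
  (m : probability W R -> nat -> 'cV[R]_p -> 'cV[R]_q -> 'cV[R]_k)
  (* (A1) *)
  (beta : probability W R -> 'cV[R]_q -> 'cV[R]_p)
  (betahat : nat -> W -> 'cV[R]_q -> 'cV[R]_p)
  (d' : measure_display) (W' : measurableType d')
  (Q : probability W R -> probability W' R)
  (GL : probability W R -> W' -> 'cV[R]_p -> 'cV[R]_q -> 'cV[R]_k)
  (Gbeta : probability W R -> W' -> 'cV[R]_q -> 'cV[R]_p)
  (SigmaL : probability W R ->
     'cV[R]_p -> 'cV[R]_q -> 'cV[R]_p -> 'cV[R]_q -> 'M[R]_(k + p))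
  (G := fun P w (z : 'cV[R]_p * 'cV[R]_q) =>
     col_mx (GL P w z.1 z.2) (Gbeta P w z.2))
  (A1_interior : forall P, P0 P -> forall t, Theta t -> (interior B) (beta P t))
  (A1_moment : forall P, P0 P -> forall T, (0 < T)%N ->
     m P T (beta P theta0) theta0 = 0%R)
  (A1_betahat : forall T, (0 < T)%N -> forall w t, Theta t ->
     B (betahat T w t))
  (A1_weak :
     (fun T : nat => \usup_(P in P0)
        BL_dist (B `*` Theta) P
          (fun w z => col_mx (g T w z.1 z.2 - m P T z.1 z.2)%R
             (Num.sqrt T%:R *: (betahat T w z.2 - beta P z.2))%R)
          (Q P) (G P)) @ \oo --> 0)
  (A1_borel : forall P, P0 P -> borel_element (B `*` Theta) (G P))
  (A1_gaussian : forall P, P0 P ->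
     mean_zero_gaussian_process (Q P) (B `*` Theta) (G P)
       (fun z z1 => SigmaL P z.1 z.2 z1.1 z1.2))
  (A1_equicontinuous : uniformly_equicontinuous P0 (B `*` Theta) Q G)
  (A1_bounded : uniformly_bounded P0 (B `*` Theta) Q G)
  (* (A2) *)
  (lambda : R) (lambda_gt0 : (0 < lambda)%R)
  (A2_min : (lambda^-1)%:E <=
     \uinf_(P in P0) \uinf_(t in Theta)
       (lambda_min (SigmaL P (beta P t) t (beta P t) t))%:E)
  (A2_min_max :
     \uinf_(P in P0) \uinf_(t in Theta)
       (lambda_min (SigmaL P (beta P t) t (beta P t) t))%:E <=
     \usup_(P in P0) \usup_(t in Theta)
       (lambda_max (SigmaL P (beta P t) t (beta P t) t))%:E)
  (A2_max :
     \usup_(P in P0) \usup_(t in Theta)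
       (lambda_max (SigmaL P (beta P t) t (beta P t) t))%:E <= lambda%:E)
  (A2_continuous : forall delta : nat -> R,
     (forall T, (0 < delta T)%R) -> delta @ \oo --> (0%R : R) ->
     (fun T : nat => \usup_(P in P0) \usup_(t in Theta) \usup_(t1 in Theta)
        \usup_(b in [set b | B b /\ (enorm (b - beta P t) < delta T)%R])
        \usup_(b1 in [set b1 | B b1 /\ (enorm (b1 - beta P t1) < delta T)%R])
          (opnorm (SigmaL P b t b1 t1
                   - SigmaL P (beta P t) t (beta P t1) t1))%:E)
       @ \oo --> 0)
  (* (A3) *)
  (SigmaLhat : nat -> W ->
     'cV[R]_p -> 'cV[R]_q -> 'cV[R]_p -> 'cV[R]_q -> 'M[R]_(k + p))
  (A3 : forall eps : R, (0 < eps)%R ->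
     (fun T : nat => \usup_(P in P0) outer_prob P
        [set w | eps%:E <
           \usup_(b in B) \usup_(t in Theta) \usup_(b1 in B) \usup_(t1 in Theta)
             (opnorm (SigmaLhat T w b t b1 t1 - SigmaL P b t b1 t1))%:E])
       @ \oo --> 0)
  (* (A4) *)
  (delta : nat -> R)
  (delta_infty : delta @ \oo --> +oo%R)
  (delta_sqrt : (fun T : nat => delta T / Num.sqrt T%:R)%R @ \oo --> (0%R : R))
  (M : probability W R -> nat -> 'cV[R]_q -> 'M[R]_(k, p))
  (A4_expansion :
     (fun T : nat => \usup_(P in P0) \usup_(t in Theta)
        \usup_(b in [set b | B b /\
            (Num.sqrt T%:R * enorm (b - beta P t) <= delta T)%R])
          (enorm (m P T b t - m P T (beta P t) t
                  - M P T t *m (Num.sqrt T%:R *: (b - beta P t)))%R)%:E)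
       @ \oo --> 0)
  (A4_bounded :
     \usup_(T in [set T : nat | (0 < T)%N]) \usup_(P in P0) \usup_(t in Theta)
       (opnorm (M P T t))%:E < +oo)
  (Mhat : nat -> W -> 'cV[R]_q -> 'M[R]_(k, p))
  (A4_consistent : forall eps : R, (0 < eps)%R ->
     (fun T : nat => \usup_(P in P0) outer_prob P
        [set w | eps%:E <
           \usup_(t in Theta) (opnorm (Mhat T w t - M P T t))%:E])
       @ \oo --> 0)
  (gT := fun (T : nat) w t => g T w (betahat T w t) t)
  (mT := fun P (T : nat) t => m P T (beta P t) t)
  (Sigma := fun P (T : nat) => concentrated_cov (M P T) (SigmaL P) (beta P))
  (Sigmahat := fun (T : nat) w =>
     concentrated_cov (Mhat T w) (SigmaLhat T w) (betahat T w)) :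
  [/\ (* (1) *)
      exists (d2 : measure_display) (W2 : measurableType d2)
        (Q2 : probability W R -> nat -> probability W2 R)
        (G2 : probability W R -> nat -> W2 -> 'cV[R]_q -> 'cV[R]_k),
        (forall P, P0 P -> forall T, (0 < T)%N ->
           borel_element Theta (G2 P T) /\
           mean_zero_gaussian_process (Q2 P T) Theta (G2 P T) (Sigma P T)) /\
        (fun T : nat => \usup_(P in P0)
           BL_dist Theta P (fun w t => gT T w t - mT P T t)%R
             (Q2 P T) (G2 P T)) @ \oo --> 0,
      (* (2) *)
      exists2 lambda1 : R, (0 < lambda1)%R &
        forall T : nat, (0 < T)%N ->
        [/\ (lambda1^-1)%:E <= \uinf_(P in P0) \uinf_(t in Theta)
              (lambda_min (Sigma P T t t))%:E,
            \uinf_(P in P0) \uinf_(t in Theta)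
              (lambda_min (Sigma P T t t))%:E <=
            \usup_(P in P0) \usup_(t in Theta)
              (lambda_max (Sigma P T t t))%:E &
            \usup_(P in P0) \usup_(t in Theta)
              (lambda_max (Sigma P T t t))%:E <= lambda1%:E] &
      (* (3) *)
      forall eps : R, (0 < eps)%R ->
        (fun T : nat => \usup_(P in P0) outer_prob P
           [set w | eps%:E < \usup_(t in Theta) \usup_(t1 in Theta)
              (opnorm (Sigmahat T w t t1 - Sigma P T t t1))%:E])
          @ \oo --> 0].
Proof.
(* Over an empty class the suprema in (A1) would all be -oo and could not tend to 0. *)
have [P1 P01] : P0 !=set0.
  apply: contrapT => P0e; have [+ _] := (fine_cvgP _ _).1 A1_weak.
  move=> [T _ /(_ T (leqnn T))]; rewrite (_ : ereal_sup _ = -oo)//.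
  apply/eqP; rewrite -leeNy_eq; apply/usup_leP => P PP.
  by exfalso; apply: P0e; exists P.
have Bbeta P t : P0 P -> Theta t -> B (beta P t).
  by move=> PP Tt; apply: interior_subset; exact: A1_interior.
have T0 : Theta !=set0 by exists theta0.
pose A := B `*` Theta.
have A0 : A !=set0 by exists (beta P1 theta0, theta0); split => //; exact: Bbeta.
pose xi P T w z := col_mx (g T w z.1 z.2 - m P T z.1 z.2)
  (Num.sqrt T%:R *: (betahat T w z.2 - beta P z.2)) : 'cV[R]_(k + p).
have [Mb Mb0 MMb] : exists2 Mb : R, (0 <= Mb)%R & forall T, (0 < T)%N ->
    forall P t, P0 P -> Theta t -> (opnorm (M P T t) <= Mb)%R.
  move: A4_bounded; set s := ereal_sup _ => soo.
  have sM T P t : (0 < T)%N -> P0 P -> Theta t -> (opnorm (M P T t))%:E <= s.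
    move=> T1 PP Tt; apply: (@le_usup _ _ [set T | (0 < T)%N] _ T _ T1).
    by apply: (le_usup PP); exact: (le_usup Tt).
  have s0 : 0 <= s.
    apply: le_trans (sM 1%N P1 theta0 isT P01 theta0_in).
    by rewrite lee_fin opnorm_ge0.
  have sfin : s \is a fin_num by rewrite ge0_fin_numE.
  exists (fine s); first exact: fine_ge0.
  by move=> T T1 P t PP Tt; rewrite -lee_fin fineK// sM.
have weak e : (0 < e)%R -> \forall T \near \oo, forall P, P0 P ->
    BL_dist A P (xi P T) (Q P) (G P) <= e%:E.
  move=> e0; have := cvge0_near_le A1_weak e0.
  by apply: filterS => T /usup_leP.
have bounded e : (0 < e)%R -> exists C : R, forall P, P0 P ->
    outer_prob (Q P) [set w | C%:E < \usup_(z in A) (enorm (G P w z))%:E]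
    <= e%:E.
  by move=> e0; have [C /ltW /usup_leP HC] := A1_bounded e e0; exists C.
have near_gt0 : \forall T \near \oo, (0 < T)%N by exact: nbhs_infty_gt.
have SigmaL_sym P t : P0 P -> Theta t ->
    ((SigmaL P (beta P t) t (beta P t) t)^T = SigmaL P (beta P t) t (beta P t) t)%R.
  move=> PP Tt; have Az : A (beta P t, t) by split => //; exact: Bbeta.
  exact: (gaussian_covariance_sym (A1_gaussian P PP) Az Az).
have kp0 : (0 < k + p)%N by rewrite addn_gt0 k_gt0.
have lmin P t : P0 P -> Theta t ->
    (lambda^-1 <= lambda_min (SigmaL P (beta P t) t (beta P t) t))%R.
  move=> PP Tt; rewrite -lee_fin.
  by move/uinf_geP: A2_min => /(_ P PP) /uinf_geP /(_ t Tt).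
have lmax P t : P0 P -> Theta t ->
    (lambda_max (SigmaL P (beta P t) t (beta P t) t) <= lambda)%R.
  move=> PP Tt; rewrite -lee_fin.
  by move/usup_leP: A2_max => /(_ P PP) /usup_leP /(_ t Tt).
split.
(* The limit is Phi(GG) on the space that carries GG; T enters only through M_T. *)
- exists d', W', (fun P _ => Q P), (fun P T w t =>
    row_mx 1%:M (M P T t) *m G P w (beta P t, t)).
  have PhiL P T f : P0 P -> (0 < T)%N -> BL1 Theta f ->
      lipb A (1 + Mb) 1 (fun x => f (fun t => row_mx 1%:M (M P T t) *m x (beta P t, t))).
    move=> PP T1 /(BL1P f T0) fL; rewrite -[X in lipb A X]mul1r.
    apply: (lipb_comp (Phi := fun x t => row_mx 1%:M (M P T t) *m x (beta P t, t)) _ fL).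
    move=> x y r xyr t Tt; rewrite -mulmxBr.
    apply: le_trans (enorm_row1_mx_le _ (MMb T T1 P t PP Tt)) _.
    rewrite ler_wpM2l ?addr_ge0//; apply: xyr; split => //; exact: Bbeta.
  split=> [P PP T T1|].
    split.
      move=> f /(PhiL P T f PP T1) fL.
      exact: (lipb_measurable A0 (A1_borel P PP) fL).
    have phiA t : Theta t -> A (beta P t, t) by split => //; exact: Bbeta.
    exact: (gaussian_transform (fun t => row_mx 1%:M (M P T t)) phiA
      (A1_gaussian P PP)).
  apply: cvge0_of_near => e e0.
  (* The final error is at most (14 + Mb) eps: 4 eps from the modulus, 2 eps from the size, eps from
     the expansion, and (1 + Mb + 6) eps from the distance in (A1). *)
  pose eps := Num.min 1%R (e / (15 + Mb))%R.
  have D0 : (0 < 15 + Mb)%R by rewrite ltr_wpDr.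
  have eps0 : (0 < eps)%R by rewrite lt_min ltr01 divr_gt0.
  have eps1 : (eps <= 1)%R by rewrite ge_min lexx.
  have epsD : (eps * (15 + Mb) <= e)%R.
    by rewrite -ler_pdivlMr// ge_min lexx orbT.
  have [C HC] := bounded _ eps0.
  have [del del0 /ltW /usup_leP Hdel] := A1_equicontinuous eps eps eps0 eps0.
  near=> T.
  have T1 : (0 < T)%N by near: T.
  have s0 : (0 < Num.sqrt T%:R :> R)%R by rewrite sqrtr_gt0 ltr0n.
  have Cdel : (C + 1 < Num.sqrt T%:R * del)%R.
    have : ((C + 2) / del <= Num.sqrt T%:R)%R by near: T; exact: near_le_sqrt.
    rewrite ler_pdivrMr// => /(lt_le_trans _); apply.
    by rewrite ltrD2l ltr1n.
  have Cdelta : (C + 1 <= delta T)%R.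
    by near: T; exact: (cvgryPge _).1 delta_infty _.
  have WT : forall P, P0 P -> BL_dist A P (xi P T) (Q P) (G P) <= eps%:E.
    by near: T; exact: weak.
  have expT : \usup_(P in P0) \usup_(t in Theta)
      \usup_(b in [set b | B b /\
          (Num.sqrt T%:R * enorm (b - beta P t) <= delta T)%R])
        (enorm (m P T b t - m P T (beta P t) t
                - M P T t *m (Num.sqrt T%:R *: (b - beta P t)))%R)%:E <= eps%:E.
    by near: T; exact: cvge0_near_le A4_expansion eps0.
  apply/andP; split.
    by apply: (le_usup P01); exact: BL_dist_ge0.
  apply/usup_leP => P PP; apply/usup_leP => f fBL.
  pose S := [set u : ('cV[R]_p * 'cV[R]_q) * ('cV[R]_p * 'cV[R]_q) |
       [/\ A u.1, A u.2 &
         (enorm (col_mx (u.1.1 - u.2.1) (u.1.2 - u.2.2)) < del)%R]].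
  have S0 : S !=set0.
    have [z Az] := A0; exists (z, z); split => //=.
    by rewrite !subrr col_mx0 enorm0.
  have SA : S `<=` [set u | A u.1 /\ A u.2] by move=> u [].
  pose phi (x : 'cV[R]_p * 'cV[R]_q -> 'cV[R]_(k + p)) :=
    (2 * mod_fun S x + 2 * size_fun A C x + eps)%R.
  have FL : lipb A 2 1 (@mod_fun R _ (k + p) S) := lipb_mod_fun S0 SA.
  have HL : lipb A 1 1 (@size_fun R _ (k + p) A C) := lipb_size_fun C A0.
  (* The Lipschitz constant is 2 * 2 + 2 * 1 = 6, and the bound 2 + 2 + eps is at most 6. *)
  have phiL : lipb A 6 6 phi.
    apply: le_lipb
      (lipbD (lipbD (lipbZ 2%R FL) (lipbZ 2%R HL)) (lipb_cst A eps)) => //.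
      by rewrite ger0_norm//; lra.
    by rewrite !ger0_norm//; [lra|exact: ltW].
  have fL : lipb A (1 + Mb) (1 + Mb) (fun x =>
      f (fun t => row_mx 1%:M (M P T t) *m x (beta P t, t))).
    by apply: le_lipb (PhiL P T f PP T1 fBL) => //; rewrite lerDl.
  have MM0 : (0 < 1 + Mb)%R by rewrite ltr_wpDr.
  apply: le_trans (outer_expectation_sandwich (A := A) (X := xi P T) (phi := phi)
    (e := eps) A0 (A1_borel P PP) MM0 (ltr0n _ 6) fL phiL _ (WT P PP)) _.
    move=> w; apply: (concentration_path (g T w) (s := Num.sqrt T%:R) (del := del)
      (b := beta P) (bh := betahat T w) (M := M P T) (m := m P T)) => //.
    - by move=> t Tt; exact: Bbeta.
    - by move=> t Tt; exact: A1_betahat.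
    - move=> t Tt near_b; rewrite -lee_fin.
      move/usup_leP: expT => /(_ P PP) /usup_leP /(_ t Tt) /usup_leP.
      apply; split; first exact: A1_betahat.
      exact: le_trans near_b Cdelta.
    - exact: ltW.
  rewrite lee_fin.
  have iL K b (h : ('cV[R]_p * 'cV[R]_q -> 'cV[R]_(k + p)) -> R) : lipb A K b h ->
      (Q P).-integrable setT (EFin \o (fun w => h (G P w))).
    move=> hL; apply: bounded_integrable (lipb_measurable A0 (A1_borel P PP) hL) _.
    by move=> w; exact: hL.1.
  rewrite /phi RintegralD//; last 2 first.
  - exact: iL (lipbD (lipbZ 2%R FL) (lipbZ 2%R HL)).
  - exact: iL (lipb_cst A eps).
  rewrite RintegralD//; last 2 first.
  - exact: iL (lipbZ 2%R FL).
  - exact: iL (lipbZ 2%R HL).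
  rewrite RintegralZl//; last exact: iL FL.
  rewrite RintegralZl//; last exact: iL HL.
  rewrite Rintegral_cst// (_ : fine _ = 1%R); last first.
    by rewrite -[RHS]/(fine 1); congr fine; exact: probability_setT.
  have Fle := Rintegral_mod_fun A0 (A1_borel P PP) S0 SA (ltW eps0) (Hdel P PP).
  have Hle := Rintegral_size_fun A0 (A1_borel P PP) (HC P PP).
  by lra.
- exists (lambda * (1 + Mb) ^+ 2)%R; first by rewrite mulr_gt0// exprn_gt0// ltr_wpDr.
  move=> T T1.
  have cl P t (PP : P0 P) (Tt : Theta t) := congruence_lambda k_gt0
    (SigmaL_sym P t PP Tt) lambda_gt0 (MMb T T1 P t PP Tt) (lmin P t PP Tt)
    (lmax P t PP Tt).
  split.
  + apply/uinf_geP => P PP; apply/uinf_geP => t Tt; rewrite lee_fin.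
    by have [] := cl P t PP Tt.
  (* The infimum and the supremum are compared at one common point, P1 and theta0. *)
  + apply: (ge_uinf P01); apply: (ge_uinf theta0_in).
    apply: (le_usup P01); apply: (le_usup theta0_in); rewrite lee_fin.
    by have [] := cl P1 theta0 P01 theta0_in.
  + apply/usup_leP => P PP; apply/usup_leP => t Tt; rewrite lee_fin.
    by have [] := cl P t PP Tt.
- move=> eps eps0; apply: cvge0_of_near => e e0.
  (* The bound of [concentrated_cov_dist] with eta' = 2 eta, divided by eta and estimated with eta
     <= 1. *)
  pose D := ((lambda + 2) * (2 + Mb) + 2 * (1 + Mb) * (2 + Mb)
    + (1 + Mb) * lambda)%R.
  have D0 : (0 < D)%R.
    have [l2 M1 M2] : [/\ 0 < lambda + 2, 0 < 1 + Mb & 0 < 2 + Mb]%R by split; lra.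
    by apply: addr_gt0; [apply: addr_gt0|]; rewrite !mulr_gt0.
  pose eta := Num.min 1%R (eps / D)%R.
  have eta0 : (0 < eta)%R by rewrite lt_min ltr01 divr_gt0.
  have eta1 : (eta <= 1)%R by rewrite ge_min lexx.
  have etaD : (eta * D <= eps)%R by rewrite -ler_pdivlMr// ge_min lexx orbT.
  (* Four errors of e / 5: (A3), (A4), the tail of GG and the distance in (A1). The remaining slack
     makes the bounds strict for [outer_probU_lt]. *)
  have e50 : (0 < e / 5)%R by rewrite divr_gt0.
  have [C HC] := bounded _ e50.
  (* Positive and larger than C + 1, so off the exceptional event betahat lies strictly within c /
     sqrt(T) of beta. *)
  pose c : R := (`|C| + 2)%R.
  have c0 : (0 < c)%R by rewrite ltr_wpDl.
  (* The maximum with 1 keeps the radius positive at T = 0, as (A2) asks. *)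
  pose dl (T : nat) : R := (c / Num.sqrt (maxn T 1)%:R)%R.
  have sq0 T : (0 < T)%N -> (0 < Num.sqrt T%:R :> R)%R.
    by move=> T1; rewrite sqrtr_gt0 ltr0n.
  have dl0 T : (0 < dl T)%R by rewrite divr_gt0// sq0// leq_max orbT.
  have dl_cvg : dl @ \oo --> (0%R : R).
    apply/cvgrPdist_le => r r0; near=> T.
    have T1 : (0 < T)%N by near: T.
    rewrite sub0r normrN (ger0_norm (ltW (dl0 T))) /dl (maxn_idPl T1).
    rewrite ler_pdivrMr ?sq0// mulrC -ler_pdivrMr//.
    by near: T; exact: near_le_sqrt.
  near=> T.
  have T1 : (0 < T)%N by near: T.
  have sT := sq0 T T1.
  have WT : forall P, P0 P -> BL_dist A P (xi P T) (Q P) (G P) <= (e / 5)%:E.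
    by near: T; exact: weak.
  have [ST MT] : (\usup_(P in P0) outer_prob P
        [set w | eta%:E <
           \usup_(b in B) \usup_(t in Theta) \usup_(b1 in B) \usup_(t1 in Theta)
             (opnorm (SigmaLhat T w b t b1 t1 - SigmaL P b t b1 t1))%:E]
        <= (e / 5)%:E) /\
     (\usup_(P in P0) outer_prob P
        [set w | eta%:E <
           \usup_(t in Theta) (opnorm (Mhat T w t - M P T t))%:E]
        <= (e / 5)%:E).
    split; near: T.
    - exact: cvge0_near_le (A3 eta eta0) e50.
    - exact: cvge0_near_le (A4_consistent eta eta0) e50.
  have SlT : \usup_(P in P0) \usup_(t in Theta) \usup_(t1 in Theta)
        \usup_(b in [set b | B b /\ (enorm (b - beta P t) < dl T)%R])
        \usup_(b1 in [set b1 | B b1 /\ (enorm (b1 - beta P t1) < dl T)%R])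
          (opnorm (SigmaL P b t b1 t1
                   - SigmaL P (beta P t) t (beta P t1) t1))%:E <= eta%:E.
    by near: T; exact: cvge0_near_le (A2_continuous dl dl0 dl_cvg) eta0.
  apply/andP; split; first by apply: (le_usup P01); exact: outer_prob_ge0.
  apply/usup_leP => P PP.
  move/usup_leP: ST => /(_ P PP) ST; move/usup_leP: MT => /(_ P PP) MT.
  have XT := outer_prob_size A0 (A1_borel P PP) (HC P PP) (WT P PP).
  have lt_e (a b : R) x : x <= a%:E -> (a < b)%R -> x < b%:E.
    by move=> /le_lt_trans + ab; apply; rewrite lte_fin.
  have lt45 : (e / 5 < e / 4)%R by lra.
  have lt25 : (e / 5 + e / 5 < e / 2)%R by lra.
  have := outer_probU_lt (outer_probU_lt (lt_e _ _ _ ST lt45)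
    (lt_e _ _ _ MT lt45)) (lt_e _ _ _ XT lt25).
  rewrite -!EFinD (_ : e / 4 + e / 4 + e / 2 = e)%R; last by lra.
  move=> /ltW; apply: le_trans.
  (* Outside the three exceptional events, the rest is a deterministic estimate for a fixed sample
     point. *)
  apply: le_outer_prob => w /= Sw; apply: contrapT => good.
  move: Sw; apply/negP; rewrite -leNgt.
  have goodS : \usup_(b in B) \usup_(t in Theta) \usup_(b1 in B)
      \usup_(t1 in Theta)
      (opnorm (SigmaLhat T w b t b1 t1 - SigmaL P b t b1 t1))%:E <= eta%:E.
    by rewrite leNgt; apply/negP => h; apply: good; left; left.
  have goodM t : Theta t -> (opnorm (Mhat T w t - M P T t) <= eta)%R.
    move=> Tt; rewrite -lee_fin; apply: (@usup_leP R _ Theta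
      (fun t => (opnorm (Mhat T w t - M P T t))%:E) _).1 _ _ Tt.
    by rewrite leNgt; apply/negP => h; apply: good; left; right.
  have goodb t : Theta t -> (enorm (betahat T w t - beta P t) < dl T)%R.
    move=> Tt; rewrite /dl (maxn_idPl T1) ltr_pdivlMr// mulrC.
    have : ~ (C + 1 < enorm (xi P T w (beta P t, t)))%R.
      move=> h; apply: good; right; exists (beta P t, t) => //.
      by split => //; exact: Bbeta.
    move=> /negP; rewrite -leNgt => xC.
    have : (Num.sqrt T%:R * enorm (betahat T w t - beta P t) <= C + 1)%R.
      apply: le_trans xC; rewrite -[X in (X * _)%R]gtr0_norm// -enormZ.
      exact: enorm_col_mx_down.
    move=> /le_lt_trans; apply; rewrite /c; have := ler_norm C; lra.
  apply/usup_leP => t Tt; apply/usup_leP => t1 Tt1; rewrite lee_fin.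
  have Bh u : Theta u -> B (betahat T w u) by exact: A1_betahat.
  have Slam : (opnorm (SigmaL P (beta P t) t (beta P t1) t1) <= lambda)%R.
    have As u : Theta u -> A (beta P u, u) by split => //; exact: Bbeta.
    apply: (gaussian_covariance_opnorm (A1_gaussian P PP) (As t Tt) (As t1 Tt1)).
    - exact: ltW.
    - move=> x; apply: le_trans (dot_le_lambda_max _ kp0 (SigmaL_sym P t PP Tt)) _.
      by rewrite ler_wpM2r ?dotxx_ge0// lmax.
    - move=> x; apply: le_trans (dot_le_lambda_max _ kp0 (SigmaL_sym P t1 PP Tt1)) _.
      by rewrite ler_wpM2r ?dotxx_ge0// lmax.
  (* One [eta] from estimating Sigma_L at betahat, by (A3), and one from moving betahat to beta, by
     (A2). *)
  have Sdist : (opnorm (SigmaLhat T w (betahat T w t) t (betahat T w t1) t1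
      - SigmaL P (beta P t) t (beta P t1) t1) <= 2 * eta)%R.
    have h1 : (opnorm (SigmaLhat T w (betahat T w t) t (betahat T w t1) t1
        - SigmaL P (betahat T w t) t (betahat T w t1) t1) <= eta)%R.
      rewrite -lee_fin; move/usup_leP: goodS => /(_ _ (Bh t Tt)).
      move=> /usup_leP /(_ t Tt) /usup_leP /(_ _ (Bh t1 Tt1)).
      by move=> /usup_leP /(_ t1 Tt1).
    have h2 : (opnorm (SigmaL P (betahat T w t) t (betahat T w t1) t1
        - SigmaL P (beta P t) t (beta P t1) t1) <= eta)%R.
      rewrite -lee_fin; move/usup_leP: SlT => /(_ P PP).
      move=> /usup_leP /(_ t Tt) /usup_leP /(_ t1 Tt1).
      move=> /usup_leP /(_ _ (conj (Bh t Tt) (goodb t Tt))).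
      by move=> /usup_leP /(_ _ (conj (Bh t1 Tt1) (goodb t1 Tt1))).
    have := opnormD (SigmaLhat T w (betahat T w t) t (betahat T w t1) t1
        - SigmaL P (betahat T w t) t (betahat T w t1) t1)
      (SigmaL P (betahat T w t) t (betahat T w t1) t1
        - SigmaL P (beta P t) t (beta P t1) t1).
    by rewrite addrA subrK; lra.
  have MM u : u = t \/ u = t1 ->
      (opnorm (M P T u) <= Mb)%R /\ (opnorm (Mhat T w u - M P T u) <= eta)%R.
    by move=> [->|->]; split; [exact: MMb|exact: goodM|exact: MMb|exact: goodM].
  have eta20 : (0 <= 2 * eta)%R by lra.
  apply: le_trans (concentrated_cov_dist (ltW eta0) eta20 (ltW lambda_gt0) Mb0
    MM Slam Sdist) _.
  apply: le_trans etaD; rewrite /D.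
  have a1 : ((lambda + 2 * eta) * (1 + Mb + eta) <= (lambda + 2) * (2 + Mb))%R.
    by apply: ler_pM; lra.
  have a2 : ((1 + Mb) * (1 + Mb + eta) <= (1 + Mb) * (2 + Mb))%R.
    by apply: ler_pM; lra.
  rewrite [leLHS](_ : _ = eta * ((lambda + 2 * eta) * (1 + Mb + eta) +
    2 * ((1 + Mb) * (1 + Mb + eta)) + (1 + Mb) * lambda))%R; last by ring.
  by rewrite ler_wpM2l ?(ltW eta0)//; lra.
Unshelve. all: by end_near.
Qed.
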